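(* Let $(\Omega,\mathcal{F},\mathbb{P})$ be a probability space and let $Y_1,\dots,Y_T$ be random vectors in $\mathbb{R}^{n_y}$ such that $\mathbb{E}[\|Y_i\|_2^k]<\infty$ for every $i\in\{1,\dots,T\}$ and every $k\in\mathbb{N}$. Fix $x_0\in\mathbb{R}^{n_x}$, a nominal control $u\in U$ that is left continuous at $\tau$, where $\tau\in(0,1)$, and $v\in B(0,\rho_{\max})$. For $\epsilon\in[0,\tau]$ let $u^\epsilon(t)=v$ for $t\in(\tau-\epsilon,\tau]$ and $u^\epsilon(t)=u(t)$ otherwise, and let $x^\epsilon$ be the (random) state trajectory generated from $x_0$ by $u^\epsilon$ and the observations $y_i=Y_i(\omega)$; write $x=x^0$. Then the right derivative $$\frac{\partial_+}{\partial\epsilon}\mathbb{E}\left[\int_0^T c(x^\epsilon(t),u^\epsilon(t))\,dt+h(x^\epsilon(T))\right]\Bigg|_{\epsilon=0}$$ exists and equals $$c(x(\tau),v)-c(x(\tau),u(\tau))+\mathbb{E}\left[\int_\tau^T\frac{\partial}{\partial x}c(x(t),u(t))^{\mathrm{T}}\Psi(t)\,dt+\frac{\partial}{\partial x}h(x(T))^{\mathrm{T}}\Psi(T)\right],$$ where, for each $\omega$ and $t\in[\tau,T]$, $\Psi(t)=\lim_{\epsilon\to0^+}(x^\epsilon(t)-x(t))/\epsilon$ is the state variation.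
   Context: Fix positive integers $T,m,n_x,n_y$ and $\rho_{\max}\in(0,\infty)$; $B(0,\rho_{\max})$ is the closed Euclidean ball of radius $\rho_{\max}$ about $0$ in $\mathbb{R}^m$. $U$ is the set of piecewise continuous $u:[0,T]\to\mathbb{R}^m$ with $\|u(t)\|_2\le\rho_{\max}$ for all $t$. Dynamics: $f:\mathbb{R}^{n_x}\times\mathbb{R}^m\to\mathbb{R}^{n_x}$ is continuously differentiable and there is $K_1\in[1,\infty)$ with $\|f(x',u')-f(x'',u'')\|_2\le K_1(\|x'-x''\|_2+\|u'-u''\|_2)$ for all $x',x''\in\mathbb{R}^{n_x}$, $u',u''\in B(0,\rho_{\max})$. $g:\mathbb{R}^{n_x}\times\mathbb{R}^{n_y}\to\mathbb{R}^{n_x}$ is continuous and differentiable in its first argument, and there are constants $K_2,K_3,K_4,K_5\ge0$ and positive integers $L_1,L_2$ such that for all $x,y$ both $\|g(x,y)\|_2$ and the operator 2-norm $\|\frac{\partial}{\partial x}g(x,y)\|_2$ are at most $K_2+K_3\|x\|_2^{L_1}+K_4\|y\|_2^{L_2}+K_5\|x\|_2^{L_1}\|y\|_2^{L_2}$. Given $x_0$, a control $u\in U$ and observations $(y_1,\dots,y_T)$, the state trajectory is: $x_1$ on $[0,1]$ solves $\dot x_1=f(x_1,u)$, $x_1(0)=x_0$; for $i=2,\dots,T$, $x_i$ on $[i-1,i]$ solves $\dot x_i(t)=f(x_i(t),u(t))$ with $x_i(i-1)=g(x_{i-1}(i-1),y_{i-1})$; $x(t)=x_i(t)$ for $t\in[i-1,i)$,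 $i=1,\dots,T$, and $x(T)=g(x_T(T),y_T)$. Costs: $c:\mathbb{R}^{n_x}\times\mathbb{R}^m\to\mathbb{R}$ is continuous and continuously differentiable in $x$, $h:\mathbb{R}^{n_x}\to\mathbb{R}$ is differentiable, and there are $K_6,K_7\ge0$ and a positive integer $L_3$ such that $|c(x,u)|$, $\|\frac{\partial}{\partial x}c(x,u)\|_2$, $|h(x)|$, $\|\frac{\partial}{\partial x}h(x)\|_2$ are all at most $K_6+K_7\|x\|_2^{L_3}$ for all $x\in\mathbb{R}^{n_x}$, $u\in B(0,\rho_{\max})$. *)

(* Defs.v *)
From HB Require Import structures.
From mathcomp Require Import all_boot all_order all_algebra.
From mathcomp Require Import all_classical all_reals all_analysis.
Set Implicit Arguments.
Unset Strict Implicit.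
Unset Printing Implicit Defensive.
Import Order.TTheory GRing.Theory Num.Theory.
Import numFieldNormedType.Exports.
Local Open Scope classical_set_scope.
Local Open Scope ring_scope.

Section Defs.
Variable R : realType.

Definition norm2 (n : nat) (v : 'rV[R]_n) : R :=
  Num.sqrt (\sum_(j < n) (v ord0 j) ^+ 2).


Definition piecewise_continuous (m : nat) (Tf : R) (u : R -> 'rV[R]_m) : Prop :=
  exists (k : nat) (a : nat -> R),
    a 0%N = 0 /\ a k = Tf /\
    (forall j, (j < k)%N -> a j < a j.+1) /\
    (forall j, (j < k)%N ->
       {within `]a j, a j.+1[, continuous u} /\
       (exists l : 'rV[R]_m, u @ (a j)^'+ --> l) /\
       (exists r : 'rV[R]_m, u @ (a j.+1)^'- --> r)).

Definition admissible (m : nat) (T : nat) (rho_max : R) (u : R -> 'rV[R]_m) : Prop :=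
  piecewise_continuous T%:R u /\
  (forall t, 0 <= t <= T%:R -> norm2 (u t) <= rho_max).

Definition needle (m : nat) (u : R -> 'rV[R]_m) (tau eps : R) (v : 'rV[R]_m)
  : R -> 'rV[R]_m :=
  fun t => if (tau - eps < t) && (t <= tau) then v else u t.

(* Carathéodory (integral-form) solution of xdot = f(x,u) on [a,b] *)
Definition solves_on (nx m : nat) (f : 'rV[R]_nx -> 'rV[R]_m -> 'rV[R]_nx)
  (u : R -> 'rV[R]_m) (a b : R) (z : R -> 'rV[R]_nx) : Prop :=
  {within `[a, b], continuous z} /\
  forall t, a <= t <= b -> forall j : 'I_nx,
    z t ord0 j = z a ord0 j +
      \int[lebesgue_measure]_(s in `[a, t]) (f (z s) (u s) ord0 j).

(* the hybrid state trajectory: xs i is the piece x_i on [i-1,i] (i = 1..T),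
   x is the glued trajectory on [0,T] *)
Definition is_trajectory (nx ny m : nat) (T : nat)
  (f : 'rV[R]_nx -> 'rV[R]_m -> 'rV[R]_nx)
  (g : 'rV[R]_nx -> 'rV[R]_ny -> 'rV[R]_nx)
  (x0 : 'rV[R]_nx) (u : R -> 'rV[R]_m) (y : nat -> 'rV[R]_ny)
  (xs : nat -> R -> 'rV[R]_nx) (x : R -> 'rV[R]_nx) : Prop :=
  (forall i, (1 <= i <= T)%N -> solves_on f u i.-1%:R i%:R (xs i)) /\
  xs 1%N 0 = x0 /\
  (forall i, (2 <= i <= T)%N -> xs i i.-1%:R = g (xs i.-1 i.-1%:R) (y i.-1)) /\
  (forall i, (1 <= i <= T)%N -> forall t, i.-1%:R <= t < i%:R -> x t = xs i t) /\
  x T%:R = g (xs T T%:R) (y T).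

End Defs.

Definition rvec (R : realType) (ny : nat) (T : Type) (Y : nat -> 'I_ny -> T -> R)
  (i : nat) (w : T) : 'rV[R]_ny := \row_(j < ny) Y i j w.

(* Main.v *)
(* Fix an outcome w.  Gronwall's inequality bounds the difference quotients
   (x^e - x) / e on [0, 1], and by differentiability of f and dominated
   convergence they satisfy the linearised equation on [tau, 1] up to an error
   that vanishes with e.  Hence they are Cauchy as e -> 0+, starting from the
   average of f(x^e, v) - f(x, u) over ]tau - e, tau], which converges because u
   is left continuous at tau.  The chain rule for g carries the convergence
   through the observation times.  This yields the variation Psi and the
   pointwise derivative of the cost without solving the linearised equation.

   All bounds are polynomial in the norms of the observations, hence integrable,
   so that dominated convergence differentiates the expectation.  Measurability
   in w comes from uniqueness: by Gronwall the cost is a continuous function of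
   the observations, on whatever set of observations actually occurs. *)

Require Import Defs.
From HB Require Import structures.
From mathcomp Require Import all_boot all_order all_algebra.
From mathcomp Require Import all_classical all_reals all_analysis.
From mathcomp Require Import measurable_realfun ring lra.
Import Order.TTheory GRing.Theory Num.Theory.
Import numFieldNormedType.Exports.
Set Implicit Arguments.
Unset Strict Implicit.
Unset Printing Implicit Defensive.
Local Open Scope classical_set_scope.
Local Open Scope ring_scope.

(** Differentiability makes the linearisation error of the difference quotients vanish at each time,
    but not uniformly in time. Gronwall is therefore used with a forcing term that enters through
    its integral: for the linearisation error this integral tends to 0 by bounded convergence, and
    for the needle it is proportional to [e]. All estimates use the maximum norm of rows, for which
    a bound on every coordinate is a bound on the norm. The Euclidean hypotheses are converted once,
    in the final proof, at the price of dimension factors in the constants. Each observation may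
    raise the degree of the polynomial bounds. The fixed number [T] of observations keeps the degree
    finite, and the finiteness of all moments makes its size irrelevant. *)

Section RowNorm.
Variable R : realType.

(** * Maximum norm and Euclidean norm of rows *)

Lemma coord_le_norm n (v : 'rV[R]_n) (j : 'I_n) : `|v ord0 j| <= `|v|.
Proof.
rewrite [leRHS]/Num.norm /= mx_normrE; apply/bigmax_geP; right => /=.
by exists (ord0, j).
Qed.

Lemma norm_le_coord n (v : 'rV[R]_n) (r : R) :
  0 <= r -> (forall j, `|v ord0 j| <= r) -> `|v| <= r.
Proof.
move=> r0 H; rewrite [leLHS]/Num.norm /= mx_normrE; apply/bigmax_leP; split => //.
by move=> [i j] _ /=; rewrite (ord1 i).
Qed.

Lemma norm_le_norm2 n (v : 'rV[R]_n) : `|v| <= norm2 v.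
Proof.
apply: norm_le_coord => [|j]; first exact: sqrtr_ge0.
rewrite -sqrtr_sqr ler_wsqrtr// (bigD1 j)//= lerDl.
by apply: sumr_ge0 => i _; exact: sqr_ge0.
Qed.

(** The sharp factor is the square root of [n]; the coarser [n] is enough, since only the existence
    of constants matters. *)
Lemma norm2_le_norm n (v : 'rV[R]_n) : norm2 v <= n%:R * `|v|.
Proof.
rewrite -(@ger0_norm _ (n%:R * `|v|)) ?mulr_ge0//.
rewrite -sqrtr_sqr ler_wsqrtr//.
have H : \sum_(j < n) v ord0 j ^+ 2 <= \sum_(j < n) `|v| ^+ 2.
  apply: ler_sum => j _; rewrite -[leLHS]real_normK ?num_real//.
  by rewrite lerXn2r ?nnegrE// coord_le_norm.
apply: (le_trans H); rewrite sumr_const card_ord -[leLHS]mulr_natl exprMn.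
rewrite ler_wpM2r ?sqr_ge0//; case: n {v H} => [|n]; first by rewrite expr0n.
by rewrite expr2 ler_peMl// ler1n.
Qed.

Lemma norm2_ge0 n (v : 'rV[R]_n) : 0 <= norm2 v.
Proof. exact: sqrtr_ge0. Qed.

End RowNorm.

(** * Measurability from continuity with respect to measurable functions *)

Section MeasurableContinuousWrt.
Variable R : realType.

(* The preimages under [W] of boxes with rational centres form a countable base
   of the initial topology of [W]. *)
Lemma measurable_fun_continuous_wrt (d : measure_display) (S : measurableType d)
    (I : finType) (D : set S) (W : I -> S -> R) (F : S -> R) :
  measurable D -> (forall i, measurable_fun D (W i)) ->
  (forall w, D w -> forall e : R, 0 < e -> exists2 r : R, 0 < r &
     forall w', D w' -> (forall i, `|W i w - W i w'| < r) -> `|F w - F w'| < e) ->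
  measurable_fun D F.
Proof.
move=> mD mW cF _; apply: (measurability _ (RGenOInfty.measurableE R)) => //.
move=> _ [_ [a ->] <-].
pose box (p : {ffun I -> rat} * nat) :=
  D `&` \bigcap_(i in [set: I])
    (D `&` W i @^-1` `]ratr (p.1 i) - p.2.+1%:R^-1, ratr (p.1 i) + p.2.+1%:R^-1[%classic).
pose good p := box p `<=` F @^-1` `]a, +oo[%classic.
have mbox p : measurable (box p).
  apply: measurableI => //; apply: fin_bigcap_measurable; first exact: finite_finset.
  by move=> i _; exact: mW.
have boxP p w : D w -> box p w <-> forall i, `|W i w - ratr (p.1 i)| < p.2.+1%:R^-1.
  move=> Dw; split => [[_ bw] i|H].
    by have [_ /=] := bw i Logic.I; rewrite in_itv/= ltr_distl.
  split => // i _; split => //=; move: (H i).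
  by rewrite in_itv/= ltr_distl.
rewrite (_ : _ `&` _ = \bigcup_p (if `[< good p >] then box p else set0)).
  apply: countable_bigcupT_measurable => // p; case: ifP => // _.
apply/seteqP; split => [w [Dw /= Fw]|w [p _]]; last first.
  by case: asboolP => // gp bw; split; [case: bw|exact: gp].
rewrite in_itv/= andbT in Fw.
have [r r0 cFr] := cF w Dw (F w - a) ltac:(by rewrite subr_gt0).
(* Two points of one box differ by less than [2 / (k+1)] in every coordinate of [W]; this must not
   exceed [r]. *)
have [k kr] : exists k, k.+1%:R^-1 < r / 2.
  have := @near_infty_natSinv_lt R (PosNum (divr_gt0 r0 (ltr0n R 2))).
  by move=> [k _ /(_ k (leqnn k))] /= ?; exists k.
have k0 : 0 < k.+1%:R^-1 :> R by rewrite invr_gt0.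
have /choice[q qP] : forall i, exists q : rat, `|W i w - ratr q| < k.+1%:R^-1.
  move=> i; have := @rat_in_itvoo R (W i w - k.+1%:R^-1) (W i w + k.+1%:R^-1).
  case; first by rewrite ltrBlDr -addrA ltrDl addr_gt0.
  by move=> q; rewrite in_itv/= => qP; exists q; rewrite distrC ltr_distl.
have bw : box (finfun q, k) w.
  by apply/boxP => //= i; rewrite ffunE.
exists (finfun q, k) => //; case: asboolP => // -[] w' bw' /=.
have Dw' := bw'.1.
move: bw' => /(boxP _ _ Dw')/= bw'.
have : `|F w - F w'| < F w - a.
  apply: cFr => // i; move: (bw' i) (qP i); rewrite ffunE => H1 H2.
  rewrite (le_lt_trans (ler_distD (ratr (q i)) _ _))// (distrC (ratr _)).
  rewrite (splitr r) ltrD//; [exact: lt_trans kr|exact: lt_trans kr].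
by rewrite in_itv/= andbT ltr_norml => /andP[_]; lra.
Qed.

End MeasurableContinuousWrt.

(** * Integration of bounded measurable functions on compact intervals *)

Section BoundedMeasurable.
Variable R : realType.
Implicit Types (a b : R) (F G : R -> R).
Local Notation mu := (@lebesgue_measure R).

(** Every integrand over time is bounded on its interval. This class is stable under the operations
    used and makes integrability automatic. *)
Definition bmeas a b F :=
  measurable_fun `[a, b] F /\
  exists M : R, forall t, a <= t <= b -> `|F t| <= M.

Lemma bmeas_integrable a b F : bmeas a b F -> mu.-integrable `[a, b] (EFin \o F).
Proof.
move=> [mF [M FM]]; apply: measurable_bounded_integrable => //.
  by rewrite /= lebesgue_measure_itv/=; case: ifP => // _; rewrite -EFinB ltry.
exists M; split; first exact: num_real.
move=> x Mx t /=; rewrite in_itv/= => tab; apply: le_trans (FM _ tab) _.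
exact: ltW.
Qed.

Lemma bmeas_sub a b a' b' F : a <= a' -> b' <= b -> bmeas a b F -> bmeas a' b' F.
Proof.
move=> aa' bb' [mF [M FM]]; split.
  apply: measurable_funS mF => //; apply: subset_itv; by rewrite bnd_simp.
exists M => t /andP[at' tb']; apply: FM.
by rewrite (le_trans aa' at') (le_trans tb' bb').
Qed.

Lemma bmeas_eq a b F G :
  (forall t, a <= t <= b -> F t = G t) -> bmeas a b F -> bmeas a b G.
Proof.
move=> FG [mF [M FM]]; split.
  apply: eq_measurable_fun mF => t; rewrite inE/= in_itv/=; exact: FG.
by exists M => t tab; rewrite -FG//; exact: FM.
Qed.

Lemma bmeas_cst a b k : bmeas a b (fun=> k).
Proof. by split; [exact: measurable_cst|exists `|k|]. Qed.

Lemma bmeasD a b F G : bmeas a b F -> bmeas a b G -> bmeas a b (fun t => F t + G t).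
Proof.
move=> [mF [M FM]] [mG [N GN]]; split; first exact: measurable_funD.
exists (M + N) => t tab; rewrite (le_trans (ler_normD _ _))// lerD//; [exact: FM|exact: GN].
Qed.

Lemma bmeasB a b F G : bmeas a b F -> bmeas a b G -> bmeas a b (fun t => F t - G t).
Proof.
move=> [mF [M FM]] [mG [N GN]]; split; first exact: measurable_funB.
exists (M + N) => t tab; rewrite (le_trans (ler_normB _ _))// lerD//; [exact: FM|exact: GN].
Qed.

Lemma bmeasZ a b k F : bmeas a b F -> bmeas a b (fun t => k * F t).
Proof.
move=> [mF [M FM]]; split; first exact: measurable_funM.
exists (`|k| * M) => t tab; rewrite normrM ler_wpM2l//; exact: FM.
Qed.

Lemma bmeas_norm a b F : bmeas a b F -> bmeas a b (fun t => `|F t|).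
Proof.
move=> [mF [M FM]]; split; first exact: measurableT_comp.
by exists M => t tab; rewrite normr_id; exact: FM.
Qed.

Lemma bmeas_continuous a b F : {within `[a, b], continuous F} -> bmeas a b F.
Proof.
move=> cF; split; first exact: subspace_continuous_measurable_fun.
have [ba|ab] := ltP b a.
  by exists 0 => t /andP[/le_trans] /[apply]; rewrite leNgt ba.
have [s _ sP] := EVT_max ab cF; have [r _ rP] := EVT_min ab cF.
exists (`|F s| + `|F r|) => t tab.
have tI : t \in `[a, b] by rewrite in_itv.
have := sP t tI; have := rP t tI; rewrite ler_norml.
have := ler_norm (F s); have := ler_norm (- F s); have := ler_norm (F r); have := ler_norm (- F r).
rewrite !normrN; move=> *; apply/andP; split; lra.
Qed.

Definition integ a b F := \int[mu]_(s in `[a, b]) F s.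

Lemma integ_le a b F G : bmeas a b F -> bmeas a b G ->
  (forall t, a <= t <= b -> F t <= G t) -> integ a b F <= integ a b G.
Proof.
move=> /bmeas_integrable iF /bmeas_integrable iG FG; exact: le_Rintegral.
Qed.

Lemma integ_ge0 a b F : (forall t, a <= t <= b -> 0 <= F t) -> 0 <= integ a b F.
Proof. by move=> F0; apply: Rintegral_ge0 => t; rewrite /= in_itv/=; exact: F0. Qed.

Lemma integ_norm a b F : bmeas a b F -> `|integ a b F| <= integ a b (fun t => `|F t|).
Proof. by move=> /bmeas_integrable iF; exact: le_normr_Rintegral. Qed.

Lemma integD a b F G : bmeas a b F -> bmeas a b G ->
  integ a b (fun t => F t + G t) = integ a b F + integ a b G.
Proof. by move=> /bmeas_integrable iF /bmeas_integrable iG; exact: RintegralD. Qed.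

Lemma integB a b F G : bmeas a b F -> bmeas a b G ->
  integ a b (fun t => F t - G t) = integ a b F - integ a b G.
Proof. by move=> /bmeas_integrable iF /bmeas_integrable iG; exact: RintegralB. Qed.

Lemma integZ a b k F : bmeas a b F ->
  integ a b (fun t => k * F t) = k * integ a b F.
Proof. by move=> /bmeas_integrable iF; exact: RintegralZl. Qed.

Lemma integ_cst a b k : a <= b -> integ a b (fun=> k) = k * (b - a).
Proof.
move=> ab; rewrite /integ Rintegral_cst//= lebesgue_measure_itv/= lte_fin.
by case: ltP => // ba; have -> : a = b by [apply/eqP; rewrite eq_le ab ba];
  rewrite subrr.
Qed.

Lemma integ_split a b c F : a <= b -> b <= c -> bmeas a c F ->
  integ a c F = integ a b F + integ b c F.
Proof.
move=> ab bc bF; have iF := bmeas_integrable bF.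
have := @Rintegral_itvB R F (BLeft a) (BRight c) b iF.
rewrite !bnd_simp => /(_ ab bc) H.
rewrite /integ -[X in _ + X]Rintegral_itv_obnd_cbnd; last first.
  by apply: integrableS iF => //; apply: subset_itv; rewrite bnd_simp.
by rewrite -H addrCA subrr addr0.
Qed.

Lemma eq_integ a b F G : (forall t, a <= t <= b -> F t = G t) ->
  integ a b F = integ a b G.
Proof. by move=> FG; apply: eq_Rintegral => t; rewrite inE/= in_itv/=; exact: FG. Qed.

(** A point is a null set. Excluding the left endpoint fits the needle, which takes the value [v] on
    an interval open on the left. *)
Lemma eq_integ_oc a b F G : bmeas a b F ->
  (forall t, a < t <= b -> F t = G t) -> integ a b F = integ a b G.
Proof.
move=> bF FG.
have iF : mu.-integrable `]a, b] (EFin \o F).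
  apply: integrableS (bmeas_integrable bF) => //.
  by apply: subset_itv; rewrite bnd_simp.
have iG : mu.-integrable `]a, b] (EFin \o G).
  apply: eq_integrable iF => // t; rewrite inE/= in_itv/= => tab.
  by rewrite FG.
rewrite /integ -Rintegral_itv_obnd_cbnd// -[RHS]Rintegral_itv_obnd_cbnd//.
by apply: eq_Rintegral => t; rewrite inE/= in_itv/=; exact: FG.
Qed.

Lemma integ_bound a b F M : a <= b -> bmeas a b F ->
  (forall t, a <= t <= b -> `|F t| <= M) -> `|integ a b F| <= M * (b - a).
Proof.
move=> ab bF FM; apply: le_trans (integ_norm bF) _.
rewrite -integ_cst//; apply: integ_le => //; first exact: bmeas_norm.
exact: bmeas_cst.
Qed.

Lemma integ_sub_le a b b' F : a <= b -> b <= b' -> bmeas a b' F ->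
  (forall t, a <= t <= b' -> 0 <= F t) -> integ a b F <= integ a b' F.
Proof.
move=> ab bb' bF F0; rewrite (integ_split ab bb' bF) lerDl.
by apply: integ_ge0 => t /andP[bt tb]; apply: F0; rewrite (le_trans ab bt).
Qed.

Lemma integ_xx a F : integ a a F = 0.
Proof. by rewrite /integ set_itv1 Rintegral_set1. Qed.

End BoundedMeasurable.

(** * Gronwall's inequality in integral form *)

Section Gronwall.
Variable R : realType.

Lemma within_continuousM (a b : R) (F G : R -> R) :
  {within `[a, b], continuous F} -> {within `[a, b], continuous G} ->
  {within `[a, b], continuous (fun t => F t * G t)}.
Proof. by move=> cF cG x; apply: continuousM; [exact: cF|exact: cG]. Qed.

Lemma continuous_within_itv (a b : R) (F : R -> R) : continuous F ->
  {within `[a, b], continuous F}.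
Proof. by move=> cF; exact: continuous_subspaceT. Qed.

Lemma integ_expR (a b k : R) : 0 < k -> a <= b ->
  integ a b (fun s => expR (k * (s - a))) = (expR (k * (b - a)) - 1) / k.
Proof.
move=> k0; rewrite le_eqVlt => /predU1P[<-|ab].
  by rewrite integ_xx subrr mulr0 expR0 subrr mul0r.
pose F s := k^-1 * expR (k * (s - a)).
have dF (s : R) : is_derive s 1 F (expR (k * (s - a))).
  rewrite /F; apply: is_derive_eq; rewrite /GRing.scale/=; field; lra.
have cF : continuous F.
  by move=> s; apply/differentiable_continuous/derivable1_diffP; case: (dF s).
have cE : continuous (fun s : R => expR (k * (s - a))).
  move=> s; apply: continuous_comp; last exact: continuous_expR.
  apply: continuousM; first exact: cvg_cst.
  by apply: continuousB; [exact: cvg_id|exact: cvg_cst].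
rewrite /integ /Rintegral (@continuous_FTC2 R _ F)//.
- by rewrite /= /F subrr mulr0 expR0; field; lra.
- exact: continuous_within_itv.
- split.
  + by move=> x _; case: (dF x).
  + exact/cvg_at_right_filter/cF.
  + exact/cvg_at_left_filter/cF.
- by move=> x _; rewrite derive1E; case: (dF x).
Qed.

(* The maximum of [phi t * exp (- 2 L (t - a))] absorbs half of itself. *)
Lemma gronwall (a b A L : R) (phi : R -> R) :
  a <= b -> 0 <= A -> 0 < L -> {within `[a, b], continuous phi} ->
  (forall t, a <= t <= b -> phi t <= A + L * integ a t phi) ->
  forall t, a <= t <= b -> phi t <= 2 * expR (2 * L * (b - a)) * A.
Proof.
move=> ab A0 L0 cphi H.
pose E (t : R) := expR (2 * L * (t - a)).
pose psi t := phi t * (E t)^-1.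
have E0 t : 0 < E t by exact: expR_gt0.
have cE : continuous E.
  move=> s; apply: continuous_comp; last exact: continuous_expR.
  apply: continuousM; first exact: cvg_cst.
  by apply: continuousB; [exact: cvg_id|exact: cvg_cst].
have cpsi : {within `[a, b], continuous psi}.
  apply: within_continuousM => //; apply: continuous_within_itv => s.
  by apply: continuousV; [rewrite gt_eqF|exact: cE].
have [s sab sP] := EVT_max ab cpsi; set M := psi s in sP.
have phiE t : phi t = psi t * E t by rewrite /psi mulfVK// gt_eqF.
have phiM t : a <= t <= b -> phi t <= M * E t.
  by move=> tab; rewrite phiE ler_pM2r//; apply: sP; rewrite in_itv.
rewrite in_itv/= in sab; have /andP[as_ sb] := sab.
have E1 : 1 <= E s by rewrite -expR0 ler_expR mulr_ge0 ?subr_ge0// mulr_ge0// ltW.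
have I : integ a s phi <= M * ((E s - 1) / (2 * L)).
  rewrite -integ_expR ?mulr_gt0// -integZ.
    apply: integ_le.
    - apply: bmeas_sub (bmeas_continuous cphi) => //.
    - by apply: bmeasZ; apply: bmeas_continuous; exact: continuous_within_itv.
    - by move=> t /andP[at_ ts]; apply: phiM; rewrite at_ (le_trans ts sb).
  exact/bmeas_continuous/continuous_within_itv.
have M2A : M <= 2 * A.
  have := H s sab; rewrite phiE -/M => h1.
  have h2 : L * integ a s phi <= M * (E s - 1) / 2.
    rewrite (le_trans (ler_wpM2l (ltW L0) I))// le_eqVlt; apply/orP; left; apply/eqP.
    by field; lra.
  have [M0|M0] := leP M 0; first by rewrite (le_trans M0)// mulr_ge0.
  have : M * 1 <= M * E s by rewrite ler_pM2l.
  lra.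
move=> t tab; apply: le_trans (phiM t tab) _.
have : E t <= E b by rewrite ler_expR ler_pM2l ?mulr_gt0//; case/andP: tab => *; lra.
move=> EE; rewrite (le_trans (ler_wpM2r (ltW (E0 t)) M2A))//.
by rewrite -/(E b) mulrAC ler_wpM2r// ler_wpM2l.
Qed.

End Gronwall.

(** * Right limits, dominated convergence and difference quotients *)

Section RightLimits.
Variable R : realType.

Lemma cvg_rightP (V : normedModType R) (F : R -> V) (l : V) :
  (F e @[e --> 0^'+] --> l) <->
  (forall eta : R, 0 < eta -> exists2 r : R, 0 < r &
     forall e : R, 0 < e < r -> `|l - F e| <= eta).
Proof.
split.
- move=> /cvgrPdist_le H eta eta0.
  have [r /= r0 rP] := H eta eta0; exists r => // e /andP[e0 er].
  by apply: rP => //=; rewrite sub0r normrN gtr0_norm.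
- move=> H; apply/cvgrPdist_le => eta eta0.
  have [r r0 rP] := H eta eta0; exists r => // e /=; rewrite sub0r normrN => er e0.
  by apply: rP; rewrite e0 (le_lt_trans (ler_norm e) er).
Qed.

(** Completeness supplies the limit, so the variation needs no candidate named beforehand. *)
Lemma cauchy_right_cvg (n : nat) (F : R -> 'rV[R]_n) :
  (forall eta : R, 0 < eta -> exists2 r : R, 0 < r &
     forall e e' : R, 0 < e < r -> 0 < e' < r -> `|F e - F e'| < eta) ->
  cvg (F e @[e --> 0^'+]).
Proof.
move=> H; apply/cauchy_cvgP => A /=.
rewrite -entourage_ballE => -[eta /= eta0 etaA].
have [r r0 rP] := H eta eta0.
have near_r : \forall e \near (0 : R)^'+, (0 < e < r).
  near=> e; apply/andP; split; near: e; [exact: nbhs_right_gt|exact: nbhs_right_lt].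
exists (F @` [set e | 0 < e < r], F @` [set e | 0 < e < r]) => /=.
  by split; apply: (filterS _ near_r) => e ee; exists e.
move=> [_ _] [/= [e ee <-] [e' ee' <-]]; apply: etaA => /=.
by rewrite -ball_normE /=; exact: rP.
Unshelve. all: by end_near. Qed.

Lemma cvg_right_cauchy (V : normedModType R) (F : R -> V) :
  cvg (F e @[e --> 0^'+]) ->
  forall eta : R, 0 < eta -> exists2 r : R, 0 < r &
     forall e e' : R, 0 < e < r -> 0 < e' < r -> `|F e - F e'| < eta.
Proof.
move=> /cvg_rightP H eta eta0; have eta30 : 0 < eta / 3 by rewrite divr_gt0.
have [r r0 rP] := H _ eta30.
exists r => // e e' /rP h /rP h'.
rewrite (le_lt_trans (ler_distD (lim (F e @[e --> 0^'+])) _ _))//.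
by rewrite (distrC (F e)); lra.
Qed.

Lemma eq_cvg_right (V : normedModType R) (F G : R -> V) (l : V) (e0 : R) : 0 < e0 ->
  (forall e : R, 0 < e <= e0 -> F e = G e) ->
  F e @[e --> 0^'+] --> l -> G e @[e --> 0^'+] --> l.
Proof.
move=> e00 FG /cvg_rightP H; apply/cvg_rightP => eta /H[r r0 rP].
exists (Num.min r e0) => [|e]; first by rewrite lt_min r0.
rewrite lt_min => /and3P[e_gt0 er ee0].
rewrite -FG; last by rewrite e_gt0 ltW.
by apply: rP; rewrite e_gt0.
Qed.

(** Right limits are tested along sequences, which reduces the claim to dominated convergence for
    sequences. Measurability of [F0] comes out as well, since it is a pointwise limit. *)
Lemma dominated_cvg_right (d : measure_display) (S : measurableType d)
    (mu : {measure set S -> \bar R}) (D : set S) (F : R -> S -> R) (F0 g : S -> R)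
    (e0 : R) :
  measurable D -> 0 < e0 ->
  (forall e : R, 0 < e <= e0 -> measurable_fun D (F e)) ->
  (forall e : R, 0 < e <= e0 -> forall w, D w -> `|F e w| <= g w) ->
  mu.-integrable D (EFin \o g) ->
  (forall w, D w -> F e w @[e --> 0^'+] --> F0 w) ->
  mu.-integrable D (EFin \o F0) /\
  \int[mu]_(w in D) F e w @[e --> 0^'+] --> \int[mu]_(w in D) F0 w.
Proof.
move=> mD e00 mF Fg ig FF0.
have main (s : R^nat) : (forall n, 0 < s n) -> s n @[n --> \oo] --> 0 ->
  mu.-integrable D (EFin \o F0) /\
  \int[mu]_(w in D) F (s n) w @[n --> \oo] --> \int[mu]_(w in D) F0 w.
  move=> s0 scvg; pose s' n := Num.min (s n) e0.
  have s'0 n : 0 < s' n <= e0 by rewrite /s' lt_min s0 e00 ge_min lexx orbT.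
  have ss' : \forall n \near \oo, s' n = s n.
    near=> n; rewrite /s' min_l//; near: n.
    move/cvgrPdist_le : scvg => /(_ e0 e00); apply: filterS => n.
    by rewrite sub0r normrN; apply: le_trans; exact: ler_norm.
  have s'F w : D w -> F (s' n) w @[n --> \oo] --> F0 w.
    move=> Dw; have /cvg_at_rightP/(_ s)/(_ (conj s0 scvg)) := FF0 w Dw.
    by apply: cvg_trans; apply: near_eq_cvg; apply: filterS ss' => n /= ->.
  have mF0 : measurable_fun D F0.
    by apply: (@measurable_fun_cvg _ _ _ D (fun n => F (s' n))) => // n; exact: mF.
  have [] := @dominated_convergence _ S R mu D mD (fun n => EFin \o F (s' n))
     (EFin \o F0) (EFin \o g).
  - by move=> n; apply/measurable_EFinP; exact: mF.
  - exact/measurable_EFinP.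
  - by apply: aeW => w Dw; apply: cvg_EFin; [exact: nearW|exact: s'F].
  - exact: ig.
  - by apply: aeW => w n Dw; rewrite /= lee_fin; exact: Fg.
  move=> iF0 _ H; split => //.
  have H2 : \int[mu]_(w in D) F (s' n) w @[n --> \oo] --> \int[mu]_(w in D) F0 w.
    apply: fine_cvg; rewrite fineK; last exact: integrable_fin_num.
    exact: H.
  by apply: cvg_trans H2; apply: near_eq_cvg; apply: filterS ss' => n /= ->.
split.
  (* Integrability of [F0] needs just one sequence tending to 0 from the right. *)
  have s0 n : 0 < harmonic n :> R by rewrite invr_gt0.
  by have [] := main _ s0 (@cvg_harmonic R).
apply/cvg_at_rightP => s [s0 scvg].
by have [] := main s s0 scvg.
Unshelve. all: by end_near. Qed.

Lemma bounded_cvg_integ (a b : R) (F : R -> R -> R) (F0 : R -> R) (M e0 : R) :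
  0 < e0 -> (forall e : R, 0 < e <= e0 -> bmeas a b (F e)) ->
  (forall e : R, 0 < e <= e0 -> forall t, a <= t <= b -> `|F e t| <= M) ->
  (forall t, a <= t <= b -> F e t @[e --> 0^'+] --> F0 t) ->
  bmeas a b F0 /\ integ a b (F e) @[e --> 0^'+] --> integ a b F0.
Proof.
move=> e00 bF FM FF0.
have [||||||i ic] := @dominated_cvg_right _ _ (@lebesgue_measure R) `[a, b] F F0 (fun=> M) e0.
- by [].
- by [].
- by move=> e /bF[].
- by move=> e /FM h t; rewrite /= in_itv/= => /h.
- exact: bmeas_integrable (bmeas_cst a b M).
- by move=> t; rewrite /= in_itv/= => /FF0.
split => //; split.
  by apply/measurable_EFinP; exact: measurable_int i.
(* [F0 t] lies within 1 of some [F e t]. *)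
exists (M + 1) => t tab.
have /cvg_rightP/(_ 1 ltr01)[r r0 rP] := FF0 t tab.
pose e := Num.min (r / 2) e0.
have e1 : 0 < e <= e0 by rewrite /e lt_min divr_gt0// e00 ge_min lexx orbT.
have e2 : 0 < e < r.
  by case/andP: e1 => -> _ /=; rewrite /e gt_min; apply/orP; left; lra.
have := rP e e2; have := FM e e1 t tab => h1 h2.
rewrite -(subrK (F e t) (F0 t)) (le_trans (ler_normD _ _))//; lra.
Qed.

Lemma differentiable_eps (V W : normedModType R) (F : V -> W) (p : V) :
  differentiable F p -> forall eta : R, 0 < eta -> exists2 r : R, 0 < r &
  forall h, `|h| < r -> `|F (p + h) - F p - 'd F p h| <= eta * `|h|.
Proof.
move=> dF eta eta0; have /eqaddoP H := diff_locally dF.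
have /nbhs_ballP[r /= r0 rP] := H eta eta0; exists r => // h hr.
have := rP h; rewrite -ball_normE /= sub0r normrN => /(_ hr).
by rewrite /cst/= !fctE opprD addrA (addrC h).
Qed.

(** The remainder is small compared with [q e - p], hence with [e]. The quotient of [q] only has to
    stay bounded, so the linearised equation is available before the variation is known to exist. *)
Lemma diff_remainder_cvg (V W : normedModType R) (F : V -> W) (p : V)
    (q : R -> V) (M e0 : R) :
  differentiable F p -> 0 < e0 ->
  (forall e : R, 0 < e <= e0 -> `|q e - p| <= M * e) ->
  e^-1 *: (F (q e) - F p) - 'd F p (e^-1 *: (q e - p)) @[e --> 0^'+] --> (0 : W).
Proof.
move=> dF e00 qM; apply/cvg_rightP => eta eta0.
have M0 : 0 <= M.
  have := qM e0; rewrite e00 lexx => /(_ isT) h.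
  by rewrite -(pmulr_lge0 _ e00) (le_trans _ h).
have M10 : 0 < M + 1 by lra.
(* Precision [eta / (M + 1)] against a displacement of at most [M * e]; the 1 covers [M = 0]. *)
have [r r0 rP] := differentiable_eps dF (divr_gt0 eta0 M10).
exists (Num.min (r / (M + 1)) e0) => [|e]; first by rewrite lt_min divr_gt0.
rewrite lt_min => /and3P[e_gt0 er ee0].
have qe := qM e; rewrite e_gt0 (ltW ee0) in qe; have {}qe := qe isT.
have hr : `|q e - p| < r.
  rewrite (le_lt_trans qe)//; move: er; rewrite ltr_pdivlMr//.
  by rewrite mulrC; apply: le_lt_trans; rewrite ler_wpM2r// ltW//; lra.
have := rP _ hr; rewrite (addrC p) subrK => h.
rewrite sub0r normrN linearZ -scalerBr normrZ gtr0_norm ?invr_gt0//.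
rewrite -ler_pdivlMl ?invr_gt0// invrK (le_trans h)//.
have c0 : 0 <= eta / (M + 1) by rewrite ltW// divr_gt0.
rewrite (le_trans (ler_wpM2l c0 qe))//.
have -> : eta / (M + 1) * (M * e) = eta * e * M / (M + 1) by field; lra.
by rewrite ler_pdivrMr//; have := mulr_gt0 eta0 e_gt0; lra.
Qed.

Lemma diff_quotient_cvg (V W : normedModType R) (F : V -> W) (p l : V)
    (q : R -> V) (M e0 : R) :
  differentiable F p -> 0 < e0 ->
  (forall e : R, 0 < e <= e0 -> `|q e - p| <= M * e) ->
  e^-1 *: (q e - p) @[e --> 0^'+] --> l ->
  e^-1 *: (F (q e) - F p) @[e --> 0^'+] --> 'd F p l.
Proof.
move=> dF e00 qM ql.
have h1 := diff_remainder_cvg dF e00 qM.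
have h2 : 'd F p (e^-1 *: (q e - p)) @[e --> 0^'+] --> 'd F p l.
  by apply: continuous_cvg ql; exact: diff_continuous.
rewrite -[X in _ --> X]add0r.
rewrite [X in X @ _ --> _](_ : _ = (fun e => e^-1 *: (F (q e) - F p)
  - 'd F p (e^-1 *: (q e - p))) \+ (fun e => 'd F p (e^-1 *: (q e - p)))).
  exact: cvgD.
by apply/funext => e /=; rewrite subrK.
Qed.

(** The differential in direction [h] is a limit of difference quotients, each at most [K] times the
    norm of [h]. The linearised equation thus inherits the Lipschitz constant of the original
    one. *)
Lemma diff_lipschitz (V W : normedModType R) (F : V -> W) (p : V) (K : R) :
  differentiable F p -> (forall q, `|F q - F p| <= K * `|q - p|) ->
  forall h, `|'d F p h| <= K * `|h|.
Proof.
move=> dF FK h.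
have ql : e^-1 *: (p + e *: h - p) @[e --> 0^'+] --> h.
  apply: (@eq_cvg_right _ (fun=> h) _ _ 1) => //; last exact: cvg_cst.
  move=> e /andP[e0 _]; rewrite addrC addKr scalerA mulVf ?gt_eqF// scale1r//.
have qM (e : R) : 0 < e <= 1 -> `|p + e *: h - p| <= `|h| * e.
  by move=> /andP[e0 _]; rewrite addrC addKr normrZ gtr0_norm// mulrC.
have /cvg_rightP H := diff_quotient_cvg dF ltr01 qM ql.
apply/ler_addgt0Pr => eta eta0; have [r r0 rP] := H eta eta0.
have e2 : 0 < r / 2 < r by lra.
have := rP _ e2; set e := r / 2; set x := _^-1 *: _ => h1.
have e0 : 0 < e by rewrite /e; lra.
have h2 : `|x| <= K * `|h|.
  rewrite /x normrZ gtr0_norm ?invr_gt0// ler_pdivrMl//.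
  by rewrite (le_trans (FK _))// addrC addKr normrZ gtr0_norm// mulrCA.
rewrite -(subrK x ('d F p h)) (le_trans (ler_normD _ _))//; lra.
Qed.

End RightLimits.

(** * Row-valued curves given as integrals *)

Section Primitive.
Variable R : realType.

Lemma cvg_right_coord n (F : R -> 'rV[R]_n) (l : 'rV[R]_n) (j : 'I_n) :
  F e @[e --> 0^'+] --> l -> F e ord0 j @[e --> 0^'+] --> l ord0 j.
Proof.
move=> /cvg_rightP H; apply/cvg_rightP => eta /H[r r0 rP]; exists r => // e er.
by have := coord_le_norm (l - F e) j; rewrite !mxE => /le_trans; apply; exact: rP.
Qed.

Definition bmeasv n (a b : R) (z : R -> 'rV[R]_n) :=
  forall j, bmeas a b (fun t => z t ord0 j).

Lemma bmeasv_bounded n (a b : R) (z : R -> 'rV[R]_n) : bmeasv a b z ->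
  exists2 M : R, 0 <= M & forall t, a <= t <= b -> `|z t| <= M.
Proof.
move=> bz.
have /choice[M MP] : forall j, exists M : R, forall t, a <= t <= b -> `|z t ord0 j| <= M.
  by move=> j; have [_] := bz j.
have M0 : 0 <= \sum_j `|M j| by exact: sumr_ge0.
exists (\sum_j `|M j|) => // t tab; apply: norm_le_coord => // j.
rewrite (le_trans (MP j t tab))// (le_trans (ler_norm _))// (bigD1 j)//= lerDl.
exact: sumr_ge0.
Qed.

Lemma bmeasv_sub n (a b a' b' : R) (z : R -> 'rV[R]_n) :
  a <= a' -> b' <= b -> bmeasv a b z -> bmeasv a' b' z.
Proof. by move=> aa' bb' bz j; exact: bmeas_sub (bz j). Qed.

Lemma bmeasvD n (a b : R) (z z' : R -> 'rV[R]_n) :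
  bmeasv a b z -> bmeasv a b z' -> bmeasv a b (fun t => z t + z' t).
Proof.
by move=> bz bz' j; apply: bmeas_eq (bmeasD (bz j) (bz' j)) => t _; rewrite mxE.
Qed.

Lemma bmeasvB n (a b : R) (z z' : R -> 'rV[R]_n) :
  bmeasv a b z -> bmeasv a b z' -> bmeasv a b (fun t => z t - z' t).
Proof.
by move=> bz bz' j; apply: bmeas_eq (bmeasB (bz j) (bz' j)) => t _; rewrite !mxE.
Qed.

Lemma bmeasvZ n (a b k : R) (z : R -> 'rV[R]_n) :
  bmeasv a b z -> bmeasv a b (fun t => k *: z t).
Proof. by move=> bz j; apply: bmeas_eq (bmeasZ k (bz j)) => t _; rewrite !mxE. Qed.

Lemma within_continuous_coord n (a b : R) (z : R -> 'rV[R]_n) j :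
  {within `[a, b], continuous z} ->
  {within `[a, b], continuous (fun t => z t ord0 j)}.
Proof. move=> cz x; apply: (@continuous_comp _ _ _ _ (fun v : 'rV[R]_n => v ord0 j) _ (cz x)).
exact: coord_continuous. Qed.

Lemma within_continuous_norm n (a b : R) (z : R -> 'rV[R]_n) :
  {within `[a, b], continuous z} -> {within `[a, b], continuous (fun t => `|z t|)}.
Proof. by move=> cz x; apply: continuous_comp (cz x) _; exact: norm_continuous. Qed.

Lemma bmeasv_continuous n (a b : R) (z : R -> 'rV[R]_n) :
  {within `[a, b], continuous z} -> bmeasv a b z.
Proof. by move=> cz j; exact/bmeas_continuous/within_continuous_coord. Qed.

(** The integral form of an equation whose right-hand side is already evaluated along the curve.
    Unlike solutions of a nonlinear equation, such pairs are stable under differences and multiples,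
    hence under difference quotients. *)
Definition primitive n (a b : R) (y F : R -> 'rV[R]_n) :=
  [/\ {within `[a, b], continuous y}, bmeasv a b F &
      forall t, a <= t <= b -> forall j,
        y t ord0 j = y a ord0 j + integ a t (fun s => F s ord0 j)].

Lemma primitiveB n (a b : R) (y y' F F' : R -> 'rV[R]_n) :
  primitive a b y F -> primitive a b y' F' ->
  primitive a b (fun t => y t - y' t) (fun t => F t - F' t).
Proof.
move=> [cy bF yF] [cy' bF' yF']; split.
- by move=> x; apply: continuousB; [exact: cy|exact: cy'].
- exact: bmeasvB.
- move=> t tab j; have /andP[at_ tb] := tab; rewrite !mxE (yF t tab) (yF' t tab).
  rewrite [X in _ = _ + X](_ : _ =
    integ a t (fun s => F s ord0 j) - integ a t (fun s => F' s ord0 j)); first by ring.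
  rewrite -integB; [by apply: eq_integ => s _; rewrite !mxE| |].
  + exact: bmeas_sub (bF j).
  + exact: bmeas_sub (bF' j).
Qed.

Lemma primitiveZ n (a b k : R) (y F : R -> 'rV[R]_n) :
  primitive a b y F -> primitive a b (fun t => k *: y t) (fun t => k *: F t).
Proof.
move=> [cy bF yF]; split.
- by move=> x; apply: continuousZ; [exact: cvg_cst|exact: cy].
- exact: bmeasvZ.
- move=> t tab j; have /andP[at_ tb] := tab; rewrite !mxE (yF t tab).
  rewrite mulrDr -integZ; last exact: bmeas_sub (bF j).
  by congr (_ + _); apply: eq_integ => s _; rewrite mxE.
Qed.

Lemma primitive_sub n (a b a' : R) (y F : R -> 'rV[R]_n) : a <= a' <= b ->
  primitive a b y F -> primitive a' b y F.
Proof.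
move=> aa'b [cy bF yF]; have /andP[aa' a'b] := aa'b; split.
- apply: continuous_subspaceW cy; by apply: subset_itv; rewrite bnd_simp.
- exact: bmeasv_sub bF.
- move=> t /andP[a't tb] j.
  rewrite (yF a' aa'b) (yF t); last by rewrite tb (le_trans aa').
  by rewrite (@integ_split _ a a' t)// ?addrA//; exact: bmeas_sub (bF j).
Qed.

(** At [tau] itself the needle still has the value [v], so on [[tau, 1]] it is only known to agree
    with [u] off the left endpoint. This lemma exchanges the two controls there. *)
Lemma primitive_eq_oc n (a b : R) (y F G : R -> 'rV[R]_n) :
  bmeasv a b G -> (forall t, a < t <= b -> F t = G t) ->
  primitive a b y F -> primitive a b y G.
Proof.
move=> bG FG [cy bF yF]; split => // t tab j; have /andP[at_ tb] := tab.
rewrite yF//; congr (_ + _); apply: eq_integ_oc; first exact: bmeas_sub (bF j).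
by move=> s /andP[as_ st]; rewrite FG// as_ (le_trans st tb).
Qed.

(** Bounds on the coordinates suffice because the norm is their maximum. The forcing [k] is a
    constant in the growth estimate, the effect of the needle in the perturbation estimate, and the
    linearisation error in [propagate_cvg]. *)
Lemma primitive_gronwall n (a b K : R) (y F : R -> 'rV[R]_n) (k : R -> R) :
  a <= b -> 0 < K -> primitive a b y F -> bmeas a b k ->
  (forall t, a <= t <= b -> 0 <= k t) ->
  (forall t, a <= t <= b -> forall j, `|F t ord0 j| <= K * `|y t| + k t) ->
  forall t, a <= t <= b ->
    `|y t| <= 2 * expR (2 * K * (b - a)) * (`|y a| + integ a b k).
Proof.
move=> ab K0 [cy bF yF] bk k0 FK.
have bny : bmeas a b (fun t => `|y t|) by exact/bmeas_continuous/within_continuous_norm.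
have ik0 : 0 <= integ a b k by exact: integ_ge0.
apply: gronwall => //.
- by rewrite addr_ge0.
- exact: within_continuous_norm.
move=> t tab; have /andP[at_ tb] := tab.
have bnt : bmeas a t (fun t => `|y t|) by exact: bmeas_sub bny.
have bkt : bmeas a t k by exact: bmeas_sub bk.
have iy0 : 0 <= integ a t (fun s => `|y s|) by exact: integ_ge0.
apply: norm_le_coord; first by rewrite !addr_ge0// mulr_ge0// ltW.
move=> j; rewrite yF// (le_trans (ler_normD _ _))// -addrA lerD ?coord_le_norm//.
have bFt : bmeas a t (fun s => F s ord0 j) by exact: bmeas_sub (bF j).
rewrite (le_trans (integ_norm bFt))//.
apply: (@le_trans _ _ (integ a t (fun s => K * `|y s| + k s))).
  apply: integ_le; [exact: bmeas_norm|by apply: bmeasD => //; exact: bmeasZ|].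
  by move=> s /andP[as_ st]; apply: FK; rewrite as_ (le_trans st).
rewrite integD//; last exact: bmeasZ.
rewrite (integZ K bnt) [leRHS]addrC lerD2l; exact: integ_sub_le.
Qed.

(** Joint continuity of [F] is continuity with respect to the finitely many coordinates of [z] and
    [u], which are measurable; no sigma-algebra on rows enters. *)
Lemma measurable_fun_comp2 n m (a b : R) (F : 'rV[R]_n -> 'rV[R]_m -> R)
    (z : R -> 'rV[R]_n) (u : R -> 'rV[R]_m) :
  continuous (fun q : 'rV[R]_n * 'rV[R]_m => F q.1 q.2) ->
  bmeasv a b z -> bmeasv a b u ->
  measurable_fun `[a, b] (fun t => F (z t) (u t)).
Proof.
move=> cF bz bu.
pose W (i : 'I_n + 'I_m) (t : R) :=
  match i with inl j => z t ord0 j | inr j => u t ord0 j end.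
apply: (@measurable_fun_continuous_wrt R _ _ ('I_n + 'I_m)%type _ W) => //.
  by case=> j; [case: (bz j)|case: (bu j)].
move=> t _ e e0; have /cvgrPdist_lt/(_ e e0)/nbhs_ballP[r /= r0 rP] := cF (z t, u t).
exists (r / 2); first by rewrite divr_gt0.
move=> t' _ H; apply: (rP (z t', u t')); split; rewrite -ball_normE /=.
- apply: (@le_lt_trans _ _ (r / 2)); last by lra.
  apply: norm_le_coord => [|j]; first by rewrite ltW// divr_gt0.
  by rewrite !mxE ltW//; exact: (H (inl j)).
- apply: (@le_lt_trans _ _ (r / 2)); last by lra.
  apply: norm_le_coord => [|j]; first by rewrite ltW// divr_gt0.
  by rewrite !mxE ltW//; exact: (H (inr j)).
Qed.

End Primitive.

(** * Difference quotients along a controlled flow *)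

Section Flow.
Variables (R : realType) (n m : nat) (f : 'rV[R]_n -> 'rV[R]_m -> 'rV[R]_n).
Variables (U : set 'rV[R]_m) (K Cf : R).
Hypothesis f_cont : continuous (fun q : 'rV[R]_n * 'rV[R]_m => f q.1 q.2).
Hypothesis K0 : 0 < K.
Hypothesis f_lip : forall x x' u, U u -> `|f x u - f x' u| <= K * `|x - x'|.
Hypothesis f_0 : forall u, U u -> `|f 0 u| <= Cf.
Hypothesis f_diff : forall x u, differentiable (fun z => f z u) x.

(** What the estimates use of an admissible control: piecewise continuity is reduced to
    measurability, a property that survives the insertion of a needle and the restriction to a
    subinterval. *)
Definition control (a b : R) (u : R -> 'rV[R]_m) :=
  bmeasv a b u /\ forall t, a <= t <= b -> U (u t).

Lemma f_growth x u : U u -> `|f x u| <= K * `|x| + Cf.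
Proof.
move=> Uu; rewrite -(subrK (f 0 u) (f x u)) (le_trans (ler_normD _ _))// lerD//.
  by rewrite -[x in leRHS]subr0; exact: f_lip.
exact: f_0.
Qed.

Lemma f_bmeasv (a b : R) (z : R -> 'rV[R]_n) (u : R -> 'rV[R]_m) :
  control a b u -> bmeasv a b z -> bmeasv a b (fun s => f (z s) (u s)).
Proof.
move=> [bu Uu] bz j; split.
  apply: (measurable_fun_comp2 (F := fun x v => f x v ord0 j)) => // q.
  apply/cvgrPdist_le => e e0; have /cvgrPdist_le/(_ e e0) := @f_cont q.
  apply: filterS => p; apply: le_trans.
  by have := coord_le_norm (f q.1 q.2 - f p.1 p.2) j; rewrite !mxE.
have [M M0 zM] := bmeasv_bounded bz.
exists (K * M + Cf) => t tab; rewrite (le_trans (coord_le_norm _ _))//.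
rewrite (le_trans (f_growth _ (Uu t tab)))// lerD2r ler_pM2l//; exact: zM.
Qed.

(** Base point, direction and control all vary with time. Measurability is obtained by writing the
    derivative as a limit of difference quotients of [f], which the Lipschitz condition bounds. *)
Lemma diff_f_bmeasv (a b : R) (z d : R -> 'rV[R]_n) (u : R -> 'rV[R]_m) :
  control a b u -> bmeasv a b z -> bmeasv a b d ->
  bmeasv a b (fun s => 'd (fun x => f x (u s)) (z s) (d s)).
Proof.
move=> cu bz bd j; have [M M0 dM] := bmeasv_bounded bd.
pose F (e t : R) := e^-1 * (f (z t + e *: d t) (u t) ord0 j - f (z t) (u t) ord0 j).
have [] // := @bounded_cvg_integ R a b F
  (fun t => 'd (fun x => f x (u t)) (z t) (d t) ord0 j) (K * M) 1 ltr01.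
- move=> e _; apply: bmeasZ; apply: bmeasB; last exact: f_bmeasv.
  by apply: (f_bmeasv cu); apply: bmeasvD => //; exact: bmeasvZ.
- move=> e /andP[e0 _] t tab; rewrite /F normrM gtr0_norm ?invr_gt0//.
  rewrite ler_pdivrMl//.
  have := coord_le_norm (f (z t + e *: d t) (u t) - f (z t) (u t)) j.
  rewrite !mxE => /le_trans; apply; rewrite (le_trans (f_lip _ _ (cu.2 t tab)))//.
  rewrite addrC addKr normrZ gtr0_norm// mulrCA ler_pM2l// ler_pM2l//; exact: dM.
- move=> t tab.
  have ql : e^-1 *: (z t + e *: d t - z t) @[e --> 0^'+] --> d t.
    apply: (@eq_cvg_right _ _ (fun=> d t) _ _ 1) => //; last exact: cvg_cst.
    by move=> e /andP[e0 _]; rewrite addrC addKr scalerA mulVf ?gt_eqF// scale1r.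
  have qM (e : R) : 0 < e <= 1 -> `|z t + e *: d t - z t| <= `|d t| * e.
    by move=> /andP[e0 _]; rewrite addrC addKr normrZ gtr0_norm// mulrC.
  have := cvg_right_coord (j := j) (diff_quotient_cvg (f_diff (z t) (u t)) ltr01 qM ql).
  by apply: cvg_trans; apply: near_eq_cvg; apply: nearW => e /=; rewrite /F !mxE.
Qed.

(* The difference quotients are Cauchy: by differentiability and dominated
   convergence they solve the linearised equation up to an error that vanishes
   with e, so that Gronwall compares two of them.  This yields the variation
   without an existence theorem for the linearised equation. *)
Lemma propagate_cvg (a b e0 M : R) (u : R -> 'rV[R]_m) (z0 : R -> 'rV[R]_n)
    (z : R -> R -> 'rV[R]_n) :
  a <= b -> 0 < e0 -> control a b u ->
  primitive a b z0 (fun s => f (z0 s) (u s)) ->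
  (forall e : R, 0 < e <= e0 -> primitive a b (z e) (fun s => f (z e s) (u s))) ->
  (forall e : R, 0 < e <= e0 -> forall t, a <= t <= b -> `|z e t - z0 t| <= M * e) ->
  cvg (e^-1 *: (z e a - z0 a) @[e --> 0^'+]) ->
  forall t, a <= t <= b -> cvg (e^-1 *: (z e t - z0 t) @[e --> 0^'+]).
Proof.
move=> ab e00 cu p0 pz zM cva.
pose dl (e t : R) := e^-1 *: (z e t - z0 t).
pose F (e t : R) := e^-1 *: (f (z e t) (u t) - f (z0 t) (u t)).
pose A t w := 'd (fun x => f x (u t)) (z0 t) w.
(* [r j e] is the error with which coordinate [j] of the quotient [dl e] satisfies the linearised
   equation. *)
pose r j (e t : R) : R := `|F e t ord0 j - A t (dl e t) ord0 j|.
have rge0 j e t : 0 <= r j e t by exact: normr_ge0.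
have M0 : 0 <= M.
  have := @zM e0; rewrite e00 lexx => /(_ isT a); rewrite lexx ab => /(_ isT) h.
  by rewrite -(pmulr_lge0 _ e00) (le_trans _ h).
have dlM (e t : R) : 0 < e <= e0 -> a <= t <= b -> `|dl e t| <= M.
  move=> ee tab; have /andP[e_gt0 _] := ee.
  by rewrite /dl normrZ gtr0_norm ?invr_gt0// ler_pdivrMl// mulrC; exact: zM.
have AK t w : a <= t <= b -> `|A t w| <= K * `|w|.
  move=> tab; apply: diff_lipschitz => // q; exact: f_lip (cu.2 t tab).
have FK (e t : R) : 0 < e <= e0 -> a <= t <= b -> `|F e t| <= K * M.
  move=> ee tab; have /andP[e_gt0 _] := ee.
  rewrite /F normrZ gtr0_norm ?invr_gt0// ler_pdivrMl//.
  rewrite (le_trans (f_lip _ _ (cu.2 t tab)))// mulrCA ler_pM2l// mulrC; exact: zM.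
have pdl (e : R) : 0 < e <= e0 -> primitive a b (dl e) (F e).
  by move=> ee; apply/primitiveZ/primitiveB => //; exact: pz.
have br j (e : R) : 0 < e <= e0 -> bmeas a b (r j e).
  move=> ee; have [cd bF _] := pdl e ee; apply: bmeas_norm; apply: bmeasB; first exact: bF.
  apply: (diff_f_bmeasv cu); last exact: bmeasv_continuous.
  by apply: bmeasv_continuous; case: p0.
have rM j (e t : R) : 0 < e <= e0 -> a <= t <= b -> r j e t <= K * M + K * M.
  move=> ee tab; rewrite /r (le_trans (ler_normB _ _))// lerD//.
    exact: le_trans (coord_le_norm _ _) (FK _ _ ee tab).
  rewrite (le_trans (coord_le_norm _ _))// (le_trans (AK _ _ tab))// ler_pM2l//.
  exact: dlM.
have r0 j t : a <= t <= b -> r j e t @[e --> 0^'+] --> 0.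
  move=> tab.
  suff h : F e t ord0 j - A t (dl e t) ord0 j @[e --> 0^'+] --> 0.
    by rewrite -[X in _ --> X](@normr0 R R); exact: cvg_norm.
  have qM (e : R) : 0 < e <= e0 -> `|z e t - z0 t| <= M * e by move=> ee; exact: zM.
  have := cvg_right_coord (j := j) (diff_remainder_cvg (f_diff (z0 t) (u t)) e00 qM).
  rewrite mxE; apply: cvg_trans; apply: near_eq_cvg; apply: nearW => e /=.
  by rewrite /F /A /dl !mxE.
have ir j : integ a b (r j e) @[e --> 0^'+] --> 0.
  have h e : 0 < e <= e0 -> forall t, a <= t <= b -> `|r j e t| <= K * M + K * M.
    by move=> ee t tab; rewrite normr_id; exact: rM.
  by have := (bounded_cvg_integ e00 (br j) h (r0 j)).2; rewrite integ_cst// mul0r.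
pose G := 2 * expR (2 * K * (b - a)).
have G0 : 0 < G by rewrite /G mulr_gt0// expR_gt0.
have key (e e' t : R) : 0 < e <= e0 -> 0 < e' <= e0 -> a <= t <= b ->
  `|dl e t - dl e' t| <= G * (`|dl e a - dl e' a| +
     \sum_j (integ a b (r j e) + integ a b (r j e'))).
  move=> ee ee' tab.
  (* The forcing term is the sum of the errors over all coordinates, which dominates each of them;
     induction on the index list gives its measurability and its integral. *)
  have bk (s : seq 'I_n) : bmeas a b (fun t => \sum_(j <- s) (r j e t + r j e' t)) /\
     integ a b (fun t => \sum_(j <- s) (r j e t + r j e' t)) =
     \sum_(j <- s) (integ a b (r j e) + integ a b (r j e')).
    elim: s => [|j s [bs is_]].
      split; first by apply: bmeas_eq (bmeas_cst a b 0) => s _; rewrite big_nil.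
      rewrite big_nil -[RHS](mul0r (b - a)) -integ_cst//.
      by apply: eq_integ => s _; rewrite big_nil.
    have bj : bmeas a b (fun t => r j e t + r j e' t) by apply: bmeasD; exact: br.
    split; first by apply: bmeas_eq (bmeasD bj bs) => t' _; rewrite big_cons.
    rewrite big_cons -is_ -integD; [|exact: br|exact: br].
    by rewrite -integD//; apply: eq_integ => t' _; rewrite big_cons.
  have [bk1 <-] := bk (index_enum 'I_n).
  apply: (@primitive_gronwall _ _ a b K (fun t => dl e t - dl e' t)
    (fun t => F e t - F e' t) _ ab K0 _ bk1 _ _ t tab).
  - exact: primitiveB (pdl e ee) (pdl e' ee').
  - by move=> s _; apply: sumr_ge0 => j _; exact: addr_ge0 (rge0 _ _ _) (rge0 _ _ _).
  move=> s sab j.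
  have -> : (F e s - F e' s) ord0 j =
    A s (dl e s - dl e' s) ord0 j + ((F e s ord0 j - A s (dl e s) ord0 j) -
    (F e' s ord0 j - A s (dl e' s) ord0 j)).
    by rewrite /A linearB !mxE; ring.
  rewrite (le_trans (ler_normD _ _))// lerD//.
    by rewrite (le_trans (coord_le_norm _ _))//; exact: AK.
  rewrite (le_trans (ler_normB _ _))// (bigD1 j)//= lerDl.
  by apply: sumr_ge0 => i _; exact: addr_ge0 (rge0 _ _ _) (rge0 _ _ _).
move=> t tab; apply: cauchy_right_cvg => eta eta0.
have irs : \sum_j integ a b (r j e) @[e --> 0^'+] --> 0.
  elim: (index_enum 'I_n) => [|j s IH].
    apply: (@eq_cvg_right _ _ (fun=> 0) _ _ 1 ltr01); last exact: cvg_cst.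
    by move=> e _; rewrite big_nil.
  apply: (@eq_cvg_right _ _ (fun e => integ a b (r j e) +
    \sum_(i <- s) integ a b (r i e)) _ _ 1 ltr01).
    by move=> e _; rewrite big_cons.
  by rewrite -[X in _ --> X]addr0; apply: cvgD.
(* Three terms of at most [eta / (4 * G)] are multiplied by [G]; the fourth share keeps the
   inequality strict. *)
have eta1 : 0 < eta / (4 * G) by rewrite divr_gt0// mulr_gt0.
have [r1 r10 r1P] := cvg_right_cauchy cva eta1.
have /cvg_rightP/(_ _ eta1)[r2 r20 r2P] := irs.
have {}r2P (e : R) : 0 < e < r2 -> \sum_j integ a b (r j e) <= eta / (4 * G).
  by move=> /r2P; rewrite sub0r normrN; apply: le_trans; exact: ler_norm.
exists (Num.min (Num.min r1 r2) e0) => [|e e']; first by rewrite !lt_min r10 r20.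
rewrite !lt_min => /andP[p1 /andP[/andP[p2 p3] p4]] /andP[q1 /andP[/andP[q2 q3] q4]].
rewrite (le_lt_trans (key e e' t _ _ tab)) ?p1 ?q1 ?ltW//.
have h1 := r1P e e' ltac:(by rewrite p1) ltac:(by rewrite q1).
have := r2P e; have := r2P e'; rewrite p1 p3 q1 q3 => /(_ isT) h2 /(_ isT) h3.
rewrite big_split/=.
rewrite mulrC -ltr_pdivlMr//.
have -> : eta / G = 4 * (eta / (4 * G)) by field; rewrite gt_eqF.
move: eta1 h1 h2 h3; rewrite -/(dl e a) -/(dl e' a).
set x1 := `|_|; set x2 := \sum_j _; set x3 := \sum_j _; set q := _ / _.
by move: x1 x2 x3 q => x1 x2 x3 q *; lra.
Qed.

End Flow.

(** * Mean value estimates under polynomial growth of the derivative *)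

Section MeanValue.
Variable R : realType.

(** The one-variable mean value theorem, applied to [F] along the segment from [x] to [x']. *)
Lemma mean_value_scalar (V : normedModType R) (F : V -> R) (x x' : V) (B : R) :
  (forall z, differentiable F z) ->
  (forall s : R, 0 <= s <= 1 -> `|'d F (x + s *: (x' - x)) (x' - x)| <= B) ->
  `|F x' - F x| <= B.
Proof.
move=> dF dB.
pose line (s : R) := x + s *: (x' - x).
have dline s : differentiable line s.
  by apply: differentiableD => //; apply: differentiableZl.
have dline1 s : 'd line s 1 = x' - x.
  have -> : line = cst x + ( *:%R^~ (x' - x)) by apply/funext.
  by rewrite diffD// diff_cst diff_val /= add0r scale1r.
have dphi s : differentiable (F \o line) s by exact: differentiable_comp.
have dphi1 (s : R) : is_derive s 1 (F \o line) ('d F (line s) (x' - x)).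
  split; first exact/derivable1_diffP.
  by rewrite deriveE// diff_comp//= dline1.
have cphi : {within `[0, 1], continuous (F \o line)}.
  by apply: continuous_subspaceT => s; exact: differentiable_continuous.
have [s s01] := MVT_segment ler01 (fun s _ => dphi1 s) cphi.
rewrite /= /line scale1r scale0r addr0 subr0 mulr1 (addrC x (x' - x)) subrK => ->.
by apply: dB; move: s01; rewrite in_itv.
Qed.

Lemma diff_coord n (V : normedModType R) (F : V -> 'rV[R]_n) (x w : V) (j : 'I_n) :
  differentiable F x -> 'd (fun z => F z ord0 j) x w = 'd F x w ord0 j.
Proof.
move=> dF.
have -> : (fun z => F z ord0 j) = (fun N : 'rV[R]_n => N ord0 j) \o F by [].
rewrite diff_comp//=; last exact: differentiable_coord.
have @f : {linear 'rV[R]_n -> R}.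
  by exists (fun N : 'rV[R]_n => N ord0 j); do 2![eexists]; do ?[constructor];
     rewrite ?mxE// => ? *; rewrite ?mxE//; move=> ?; rewrite !mxE.
have -> : (fun N : 'rV[R]_n => N ord0 j) = f by [].
by rewrite (@diff_lin _ _ _ f)//; exact: coord_continuous.
Qed.

Lemma segment_norm (V : normedModType R) (x x' : V) (s : R) : 0 <= s <= 1 ->
  `|x + s *: (x' - x)| <= `|x| + `|x'|.
Proof.
move=> /andP[s0 s1].
have -> : x + s *: (x' - x) = (1 - s) *: x + s *: x'.
  by rewrite scalerBr scalerBl scale1r addrCA addrC.
rewrite (le_trans (ler_normD _ _))// !normrZ !ger0_norm ?subr_ge0//.
by apply: lerD; rewrite ler_piMl//; lra.
Qed.

Lemma mean_value_growth n (F : 'rV[R]_n -> R) (C : R) (L : nat) (x x' : 'rV[R]_n) :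
  0 <= C -> (forall z, differentiable F z) ->
  (forall z w, `|'d F z w| <= C * (1 + `|z|) ^+ L * `|w|) ->
  `|F x' - F x| <= C * (1 + (`|x| + `|x'|)) ^+ L * `|x' - x|.
Proof.
move=> C0 dF FC; apply: mean_value_scalar => // s s01.
rewrite (le_trans (FC _ _))// ler_wpM2r// ler_wpM2l// lerXn2r ?nnegrE ?addr_ge0//.
by rewrite lerD2l; exact: segment_norm.
Qed.

(** The mean value theorem fails for vector values, so it is applied to each coordinate; with the
    maximum norm the constant is unchanged. *)
Lemma mean_value_growthv n k (F : 'rV[R]_n -> 'rV[R]_k) (C : R) (L : nat) (x x' : 'rV[R]_n) :
  0 <= C -> (forall z, differentiable F z) ->
  (forall z w, `|'d F z w| <= C * (1 + `|z|) ^+ L * `|w|) ->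
  `|F x' - F x| <= C * (1 + (`|x| + `|x'|)) ^+ L * `|x' - x|.
Proof.
move=> C0 dF FC; apply: norm_le_coord => [|j].
  by rewrite !mulr_ge0// exprn_ge0// !addr_ge0.
rewrite !mxE; apply: (@mean_value_growth _ (fun z => F z ord0 j)) => // [z|z w].
  exact: (differentiable_comp (dF z) (differentiable_coord _ _ _)).
by rewrite diff_coord// (le_trans (coord_le_norm _ _)).
Qed.

End MeanValue.

(** * Averages over a shrinking interval *)

Section Average.
Variable R : realType.

Lemma within_continuous_eps n (a b t : R) (z : R -> 'rV[R]_n) :
  {within `[a, b], continuous z} -> a <= t <= b ->
  forall eta : R, 0 < eta -> exists2 r : R, 0 < r &
    forall s, a <= s <= b -> `|s - t| < r -> `|z s - z t| <= eta.
Proof.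
move=> cz tab eta eta0; have tI : `[a, b]%classic t by rewrite /= in_itv.
have [r /= r0 rP] : within `[a, b] (nbhs t) (fun s => `|z t - z s| <= eta).
  by rewrite (nbhs_subspace_in tI); have /cvgrPdist_le/(_ eta eta0) := cz t.
exists r => // s sab st; rewrite distrC; apply: rP; last by rewrite /= in_itv.
by rewrite /= distrC.
Qed.

(** The integrand changes with [e] along with the interval, so closeness to [l] is required
    uniformly on the shrinking interval. *)
Lemma average_cvg (tau e0 l : R) (F : R -> R -> R) : 0 < e0 ->
  (forall e : R, 0 < e <= e0 -> bmeas (tau - e) tau (F e)) ->
  (forall eta : R, 0 < eta -> exists2 r : R, 0 < r & forall e : R, 0 < e < r ->
     forall s, tau - e <= s <= tau -> `|F e s - l| <= eta) ->
  e^-1 * integ (tau - e) tau (F e) @[e --> 0^'+] --> l.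
Proof.
move=> e00 bF Fl; apply/cvg_rightP => eta /Fl[r r0 rP].
exists (Num.min r e0) => [|e]; first by rewrite lt_min r0.
rewrite lt_min => /and3P[e_gt0 er ee0].
have bFe : bmeas (tau - e) tau (F e) by apply: bF; rewrite e_gt0 ltW.
have te : tau - e <= tau by lra.
have -> : l - e^-1 * integ (tau - e) tau (F e) =
  - (e^-1 * integ (tau - e) tau (fun s => F e s - l)).
  rewrite integB//; last exact: bmeas_cst.
  rewrite integ_cst//; field; lra.
rewrite normrN normrM gtr0_norm ?invr_gt0// ler_pdivrMl//.
have h s : tau - e <= s <= tau -> `|F e s - l| <= eta by apply: rP; rewrite e_gt0.
have := integ_bound te (bmeasB bFe (bmeas_cst _ _ l)) h.
by rewrite opprB addrCA subrr addr0 mulrC.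
Qed.

End Average.

(** * Needle variations and measurability of controls *)

Section Needle.
Variables (R : realType) (m : nat) (U : set 'rV[R]_m).

Lemma needle_control (b tau e : R) (u : R -> 'rV[R]_m) (v : 'rV[R]_m) :
  control U 0 b u -> U v -> control U 0 b (needle u tau e v).
Proof.
move=> [bu Uu] Uv; split; last first.
  by move=> t tab; rewrite /needle; case: ifP => // _; exact: Uu.
move=> j; split.
  have [mu _] := bu j.
  (* The needle is [u] plus an indicator times [v - u], a combination of measurable functions. *)
  pose A := `]tau - e, tau]%classic : set R.
  apply: (@eq_measurable_fun _ _ _ _ _
    (fun t => u t ord0 j + (\1_A t : R) * (v ord0 j - u t ord0 j))).
    move=> t _; rewrite /needle indicE /A.
    have -> : (t \in `]tau - e, tau]%classic) = (tau - e < t <= tau).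
      by apply/idP/idP; rewrite inE/= in_itv.
    by case: ifP => _; rewrite ?mulr1n ?mulr0n; ring.
  apply: measurable_funD => //; apply: measurable_funM.
    by apply: measurable_indic; exact: measurable_itv.
  by apply: measurable_funB => //; exact: measurable_cst.
have [_ [M uM]] := bu j.
exists (M + `|v ord0 j|) => t tab; rewrite /needle; have := uM t tab => h.
have := normr_ge0 (v ord0 j); have := normr_ge0 (u t ord0 j).
by case: ifP => _; lra.
Qed.

Lemma needle_left (u : R -> 'rV[R]_m) (tau e t : R) (v : 'rV[R]_m) :
  t <= tau - e -> needle u tau e v t = u t.
Proof. by rewrite /needle ltNge => ->. Qed.

Lemma needle_right (u : R -> 'rV[R]_m) (tau e t : R) (v : 'rV[R]_m) :
  tau < t -> needle u tau e v t = u t.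
Proof. by rewrite /needle ltNge => /negbTE ->; rewrite andbF. Qed.

Lemma needle_in (u : R -> 'rV[R]_m) (tau e t : R) (v : 'rV[R]_m) :
  tau - e < t <= tau -> needle u tau e v t = v.
Proof. by rewrite /needle => ->. Qed.

Lemma needle0 (u : R -> 'rV[R]_m) (tau : R) (v : 'rV[R]_m) : needle u tau 0 v = u.
Proof.
by apply/funext => t; rewrite /needle subr0; case: ltP.
Qed.

Lemma control_sub (a b a' b' : R) (u : R -> 'rV[R]_m) :
  a <= a' -> b' <= b -> control U a b u -> control U a' b' u.
Proof.
move=> aa' bb' [bu Uu]; split; first exact: bmeasv_sub bu.
by move=> t /andP[a't tb']; apply: Uu; rewrite (le_trans aa' a't) (le_trans tb' bb').
Qed.

(** The value at a breakpoint is arbitrary, so each induction step adds an open interval, where [u]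
    is continuous, and a single point. *)
Lemma piecewise_continuous_measurable (b : R) (u : R -> 'rV[R]_m) (j : 'I_m) :
  piecewise_continuous b u -> measurable_fun `[0, b] (fun t => u t ord0 j).
Proof.
move=> [k [a [a0 [ak [ai uc]]]]]; rewrite -a0 -ak.
have {}ai i : (i < k)%N -> a i < a i.+1 by exact: ai.
elim: k ai uc {ak} => [_ _|k IH ai uc].
  by rewrite set_itv1; exact: measurable_fun_set1.
have a0k : a 0%N <= a k.
  elim: k {IH uc} ai => // k IH ai; rewrite (le_trans (IH _))//.
    by move=> i ik; apply: ai; rewrite (ltn_trans ik).
  by rewrite ltW// ai.
have akk : a k < a k.+1 by exact: ai.
have -> : `[a 0%N, a k.+1]%classic =
    `[a 0%N, a k]%classic `|` (`]a k, a k.+1[%classic `|` [set a k.+1]) :> set R.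
  rewrite setUitv1 ?bnd_simp// -itv_bndbnd_setU ?bnd_simp//; lra.
apply/measurable_funU => //; first exact: measurableU.
split; first by apply: IH => [i ik|i ik]; [apply: ai|apply: uc]; rewrite (ltn_trans ik).
apply/measurable_funU => //; split; last exact: measurable_fun_set1.
have [cu _] := uc k (ltnSn k).
apply: subspace_continuous_measurable_fun => // x.
apply: (@continuous_comp _ _ _ _ (fun v : 'rV[R]_m => v ord0 j) _ (cu x)).
exact: coord_continuous.
Qed.

End Needle.

(** * Continuity in two arguments and coordinatewise right limits *)

Section PairContinuity.
Variables (R : realType) (n m : nat).

Lemma continuous_pair_eps (W : normedModType R) (F : 'rV[R]_n -> 'rV[R]_m -> W) :
  continuous (fun q : 'rV[R]_n * 'rV[R]_m => F q.1 q.2) ->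
  forall x y (eta : R), 0 < eta -> exists2 r : R, 0 < r &
  forall x' y', `|x - x'| < r -> `|y - y'| < r -> `|F x y - F x' y'| < eta.
Proof.
move=> cF x y eta eta0.
have /cvgrPdist_lt/(_ eta eta0)/nbhs_ballP[r /= r0 rP] := cF (x, y).
exists r => // x' y' hx hy; apply: (rP (x', y')).
by split; rewrite -ball_normE.
Qed.

Lemma cvg_right_rowP (F : R -> 'rV[R]_n) (l : 'rV[R]_n) :
  (forall j, F e ord0 j @[e --> 0^'+] --> l ord0 j) -> F e @[e --> 0^'+] --> l.
Proof.
move=> Fl; apply/cvg_rightP => eta eta0.
have /choice[r rP] : forall j, exists r : R, 0 < r /\
    forall e : R, 0 < e < r -> `|l ord0 j - F e ord0 j| <= eta.
  by move=> j; have /cvg_rightP/(_ eta eta0)[r r0 rP] := Fl j; exists r.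
exists (\big[Num.min/1]_j r j).
  by apply/bigmin_gtP; split=> // j _; case: (rP j).
move=> e /andP[e0 er]; apply: norm_le_coord => [|j]; first exact: ltW.
rewrite !mxE; case: (rP j) => _; apply; rewrite e0 (lt_le_trans er)//.
exact: bigmin_le_cond.
Qed.

End PairContinuity.

(** * Growth, Lipschitz and needle estimates for the flow *)

Section FlowEstimates.
Variables (R : realType) (n m : nat) (f : 'rV[R]_n -> 'rV[R]_m -> 'rV[R]_n).
Variables (U : set 'rV[R]_m) (K Cf Du : R).
Hypothesis f_cont : continuous (fun q : 'rV[R]_n * 'rV[R]_m => f q.1 q.2).
Hypothesis K0 : 0 < K.
Hypothesis f_lip : forall x x' u, U u -> `|f x u - f x' u| <= K * `|x - x'|.
Hypothesis f_0 : forall u, U u -> `|f 0 u| <= Cf.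

Lemma primitive_subr (a b b' : R) (y F : R -> 'rV[R]_n) : b' <= b ->
  primitive a b y F -> primitive a b' y F.
Proof.
move=> bb' [cy bF yF]; split.
- by apply: continuous_subspaceW cy; apply: subset_itv; rewrite bnd_simp.
- exact: bmeasv_sub bF.
- by move=> t /andP[at_ tb] j; apply: yF; rewrite at_ (le_trans tb).
Qed.

Lemma solves_on_primitive (a b : R) (u : R -> 'rV[R]_m) (z : R -> 'rV[R]_n) :
  control U a b u -> solves_on f u a b z -> primitive a b z (fun s => f (z s) (u s)).
Proof.
move=> cu [cz zP]; split => //.
by apply: (f_bmeasv f_cont K0 f_lip f_0 cu); exact: bmeasv_continuous.
Qed.

Lemma flow_growth (a b : R) (u : R -> 'rV[R]_m) (z : R -> 'rV[R]_n) :
  a <= b -> control U a b u -> primitive a b z (fun s => f (z s) (u s)) ->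
  forall t, a <= t <= b ->
    `|z t| <= 2 * expR (2 * K * (b - a)) * (`|z a| + Cf * (b - a)).
Proof.
move=> ab cu pz t tab; rewrite -(integ_cst Cf ab).
apply: (primitive_gronwall ab K0 pz _ _ _ tab); first exact: bmeas_cst.
  by move=> s sab; exact: le_trans (f_0 (cu.2 s sab)).
move=> s sab j; rewrite (le_trans (coord_le_norm _ _))//.
exact: f_growth f_lip f_0 _ _ (cu.2 s sab).
Qed.

Lemma flow_lipschitz (a b : R) (u : R -> 'rV[R]_m) (z z' : R -> 'rV[R]_n) :
  a <= b -> control U a b u ->
  primitive a b z (fun s => f (z s) (u s)) ->
  primitive a b z' (fun s => f (z' s) (u s)) ->
  forall t, a <= t <= b ->
    `|z t - z' t| <= 2 * expR (2 * K * (b - a)) * `|z a - z' a|.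
Proof.
move=> ab cu pz pz' t tab.
have := primitive_gronwall ab K0 (primitiveB pz pz') (bmeas_cst a b 0) _ _ tab.
rewrite integ_cst// mul0r addr0; apply => // s sab j.
rewrite addr0 (le_trans (coord_le_norm _ _))//; exact: f_lip (cu.2 s sab).
Qed.

Hypothesis Du0 : 0 <= Du.
Hypothesis f_lipU : forall x x' u u', U u -> U u' ->
  `|f x u - f x' u'| <= K * `|x - x'| + Du.

(** Beyond the Lipschitz term, the two right-hand sides differ by at most [Du], and only on an
    interval of length [e]. The forcing is thus [Du] times an indicator, whose integral [Du * e]
    makes the deviation of order [e]. *)
Lemma flow_needle (b tau e : R) (u : R -> 'rV[R]_m) (v : 'rV[R]_m)
    (z z' : R -> 'rV[R]_n) :
  0 <= e <= tau -> tau <= b -> control U 0 b u -> U v -> z 0 = z' 0 ->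
  primitive 0 b z (fun s => f (z s) (needle u tau e v s)) ->
  primitive 0 b z' (fun s => f (z' s) (u s)) ->
  forall t, 0 <= t <= b ->
    `|z t - z' t| <= 2 * expR (2 * K * b) * (Du * e).
Proof.
move=> /andP[e0 et] tb cu Uv zz' pz pz' t tab.
have b0 : 0 <= b by lra.
pose A := `]tau - e, tau]%classic : set R.
pose k (s : R) : R := Du * \1_A s.
have kE s : k s = if tau - e < s <= tau then Du else 0.
  rewrite /k indicE /A.
  have -> : (s \in `]tau - e, tau]%classic) = (tau - e < s <= tau).
    by apply/idP/idP; rewrite inE/= in_itv.
  by case: ifP => _; rewrite ?mulr1n ?mulr0n ?mulr1 ?mulr0.
have bk : bmeas 0 b k.
  split.
    apply: measurable_funM; first exact: measurable_cst.
    by apply: measurable_indic; exact: measurable_itv.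
  by exists Du => s _; rewrite kE; case: ifP; rewrite ?normr0// ger0_norm.
have ik : integ 0 b k = Du * e.
  rewrite (@integ_split _ 0 tau b)//; [|lra].
  rewrite (@integ_split _ 0 (tau - e) tau); [|lra|lra|exact: bmeas_sub bk].
  rewrite [X in X + _ + _](_ : _ = 0); last first.
    transitivity (integ 0 (tau - e) (fun=> 0)); last by rewrite integ_cst ?mul0r//; lra.
    by apply: eq_integ => s /andP[_ s1]; rewrite kE ltNge s1.
  rewrite [X in _ + X](_ : _ = 0); last first.
    transitivity (integ tau b (fun=> 0)); last by rewrite integ_cst ?mul0r//; lra.
    symmetry; apply: eq_integ_oc; first exact: bmeas_cst.
    by move=> s /andP[s1 _]; rewrite kE (leNgt s) s1 andbF.
  rewrite -(eq_integ_oc (bmeas_cst (tau - e) tau Du)); last by move=> s hs; rewrite kE hs.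
  rewrite integ_cst; last by lra.
  by ring.
have := primitive_gronwall b0 K0 (primitiveB pz pz') bk _ _ tab.
rewrite zz' subrr normr0 add0r ik subr0; apply.
  by move=> s _; rewrite kE; case: ifP.
move=> s sab j; rewrite (le_trans (coord_le_norm _ _))// kE /needle.
case: ifP => hs; first by apply: f_lipU => //; exact: cu.2.
rewrite addr0; exact: f_lip (cu.2 s sab).
Qed.

End FlowEstimates.

(** * The trajectory across the observation times *)

Section Hybrid.
Variables (R : realType) (T m nx ny : nat).
Variables (f : 'rV[R]_nx -> 'rV[R]_m -> 'rV[R]_nx).
Variables (g : 'rV[R]_nx -> 'rV[R]_ny -> 'rV[R]_nx).
Variables (U : set 'rV[R]_m) (K Cf Du Cg : R) (L1 L2 : nat).
Variables (Omega : Type) (y : Omega -> nat -> 'rV[R]_ny).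
Variables (x0 : 'rV[R]_nx) (u : R -> 'rV[R]_m) (tau : R) (v : 'rV[R]_m).
Variables (X : R -> Omega -> R -> 'rV[R]_nx) (XS : R -> Omega -> nat -> R -> 'rV[R]_nx).
Hypothesis T0 : (0 < T)%N.
Hypothesis f_cont : continuous (fun q : 'rV[R]_nx * 'rV[R]_m => f q.1 q.2).
Hypothesis K0 : 0 < K.
Hypothesis f_lip : forall x x' u, U u -> `|f x u - f x' u| <= K * `|x - x'|.
Hypothesis f_0 : forall u, U u -> `|f 0 u| <= Cf.
Hypothesis f_diff : forall x u, differentiable (fun z => f z u) x.
Hypothesis Du0 : 0 <= Du.
Hypothesis f_lipU : forall x x' u u', U u -> U u' ->
  `|f x u - f x' u'| <= K * `|x - x'| + Du.
Hypothesis g_cont : continuous (fun q : 'rV[R]_nx * 'rV[R]_ny => g q.1 q.2).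
Hypothesis g_diff : forall x y, differentiable (fun z => g z y) x.
Hypothesis Cg0 : 0 <= Cg.
Hypothesis g_growth : forall x y,
  `|g x y| <= Cg * (1 + `|x|) ^+ L1 * (1 + `|y|) ^+ L2.
Hypothesis dg_growth : forall x y w,
  `|'d (fun z => g z y) x w| <= Cg * (1 + `|x|) ^+ L1 * (1 + `|y|) ^+ L2 * `|w|.
Hypothesis u_ctrl : control U 0 T%:R u.
Hypothesis Uv : U v.
Hypothesis u_left : u @ tau^'- --> u tau.
Hypothesis tau01 : 0 < tau < 1.
Hypothesis traj : forall (e : R) w, 0 <= e <= tau ->
  is_trajectory T f g x0 (needle u tau e v) (y w) (XS e w) (X e w).

Let T1 : 1 <= T%:R :> R. Proof. by rewrite ler1n. Qed.
Let e0tau : (0 : R) <= 0 <= tau.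
Proof. by rewrite lexx ltW//; case/andP: tau01. Qed.

Lemma piece_length (i : nat) : (0 < i)%N -> i%:R - i.-1%:R = 1 :> R.
Proof. by case: i => // i _; rewrite /= -natrB// subSnn. Qed.

Lemma piece_end (i : nat) : (i.-1%:R : R) <= (i%:R : R) <= (i%:R : R).
Proof. by rewrite lexx andbT ler_nat leq_pred. Qed.

Lemma piece_start (e : R) w i : 0 <= e <= tau -> (2 <= i <= T)%N ->
  XS e w i i.-1%:R = g (XS e w i.-1 i.-1%:R) (y w i.-1).
Proof. by move=> /(@traj _ w)[_ [_ [H _]]]; exact: H. Qed.

Lemma piece_start1 (e : R) w : 0 <= e <= tau -> XS e w 1 0 = x0.
Proof. by move=> /(@traj _ w)[_ [? _]]. Qed.

Lemma X_piece (e : R) w i (t : R) : 0 <= e <= tau -> (1 <= i <= T)%N -> i.-1%:R <= t < i%:R ->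
  X e w t = XS e w i t.
Proof. by move=> /(@traj _ w)[_ [_ [_ [H _]]]] iT; exact: H. Qed.

Lemma X_end (e : R) w : 0 <= e <= tau -> X e w T%:R = g (XS e w T T%:R) (y w T).
Proof. by move=> /(@traj _ w)[_ [_ [_ [_ H]]]]. Qed.

Lemma piece_control (e : R) i : (1 <= i <= T)%N -> control U i.-1%:R i%:R (needle u tau e v).
Proof.
move=> /andP[i1 iT]; apply: control_sub (needle_control tau e u_ctrl Uv) => //.
by rewrite ler_nat.
Qed.

Lemma piece_primitive (e : R) w i : 0 <= e <= tau -> (1 <= i <= T)%N ->
  primitive i.-1%:R i%:R (XS e w i) (fun s => f (XS e w i s) (needle u tau e v s)).
Proof.
move=> ee iT; apply: (solves_on_primitive f_cont K0 f_lip f_0).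
  exact: piece_control.
by have [H _] := traj w ee; exact: H.
Qed.

Lemma piece_control_u i : (1 <= i <= T)%N -> control U i.-1%:R i%:R u.
Proof. by move=> /andP[i1 iT]; apply: control_sub u_ctrl => //; rewrite ler_nat. Qed.

(** From the second piece on, time is at least 1 and [tau < 1], so the needle acts only through the
    initial value of the piece. *)
Lemma piece_primitive_u (e : R) w i : 0 <= e <= tau -> (2 <= i <= T)%N ->
  primitive i.-1%:R i%:R (XS e w i) (fun s => f (XS e w i s) (u s)).
Proof.
move=> ee /andP[i2 iT]; have i1T : (1 <= i <= T)%N by rewrite (ltnW i2).
have pe := piece_primitive w ee i1T.
have [cz _ _] := pe; apply: primitive_eq_oc pe.
  apply: (f_bmeasv f_cont K0 f_lip f_0 (piece_control_u i1T)).
  exact: bmeasv_continuous.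
move=> t /andP[it _]; rewrite needle_right//.
have : 1 <= i.-1%:R :> R by rewrite ler1n -ltnS prednK// (ltnW i2).
by move: tau01; lra.
Qed.

Lemma unit_interval_ex (n : nat) (t : R) : 0 <= t < n%:R ->
  exists2 i, (1 <= i <= n)%N & i.-1%:R <= t < i%:R.
Proof.
elim: n => [|n IH] /andP[t0 tn]; first by have := le_lt_trans t0 tn; rewrite ltxx.
have [ht|ht] := ltP t n%:R.
  have [|i /andP[i1 i2] it] := IH; first by rewrite t0.
  by exists i => //; rewrite i1 (leq_trans i2).
by exists n.+1; rewrite ?leqnn//= ht.
Qed.

(** One index serves all [e] and all outcomes, so limits in [e] and comparisons of outcomes can be
    made at a fixed time. Time [T] is separate: there the glued trajectory has already made its last
    jump. *)
Lemma X_cases (t : R) : 0 <= t <= T%:R ->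
  (exists i, [/\ (1 <= i <= T)%N, i.-1%:R <= t <= i%:R &
     forall (e : R) w, 0 <= e <= tau -> X e w t = XS e w i t]) \/
  (forall (e : R) w, 0 <= e <= tau -> X e w t = g (XS e w T T%:R) (y w T)).
Proof.
move=> /andP[t0]; rewrite le_eqVlt => /predU1P[->|tT].
  by right => e w ee; exact: X_end.
left; have [|i iT it] := @unit_interval_ex T t; first by rewrite t0.
exists i; split => //; first by case/andP: it => -> /ltW.
by move=> e w ee; exact: X_piece.
Qed.

(** The Gronwall factor of an interval of length 1, common to all pieces. *)
Definition flow_const : R := 2 * expR (2 * K).

Lemma flow_const_gt0 : 0 < flow_const. Proof. by rewrite mulr_gt0// expR_gt0. Qed.

Lemma piece_growth (e : R) w i (t : R) : 0 <= e <= tau -> (1 <= i <= T)%N ->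
  i.-1%:R <= t <= i%:R -> `|XS e w i t| <= flow_const * (`|XS e w i i.-1%:R| + Cf).
Proof.
move=> ee iT tab; have /andP[i1 _] := iT.
have ii : i.-1%:R <= i%:R :> R by rewrite ler_nat leq_pred.
have := flow_growth K0 f_lip f_0 ii (piece_control e iT) (piece_primitive w ee iT) tab.
by rewrite piece_length// !mulr1.
Qed.

Lemma piece_lipschitz (e : R) w w' i (t : R) : 0 <= e <= tau -> (1 <= i <= T)%N ->
  i.-1%:R <= t <= i%:R ->
  `|XS e w i t - XS e w' i t| <= flow_const * `|XS e w i i.-1%:R - XS e w' i i.-1%:R|.
Proof.
move=> ee iT tab; have /andP[i1 _] := iT.
have ii : i.-1%:R <= i%:R :> R by rewrite ler_nat leq_pred.
have := flow_lipschitz K0 f_lip ii (piece_control e iT) (piece_primitive w ee iT)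
  (piece_primitive w' ee iT) tab.
by rewrite piece_length// !mulr1.
Qed.

Lemma piece_variation (e : R) w i (t : R) : 0 <= e <= tau -> (2 <= i <= T)%N ->
  i.-1%:R <= t <= i%:R ->
  `|XS e w i t - XS 0 w i t| <= flow_const * `|XS e w i i.-1%:R - XS 0 w i i.-1%:R|.
Proof.
move=> ee iT tab; have /andP[i2 iT'] := iT.
have ii : i.-1%:R <= i%:R :> R by rewrite ler_nat leq_pred.
have i1 : (1 <= i <= T)%N by rewrite (ltnW i2).
have := flow_lipschitz K0 f_lip ii (piece_control_u i1) (piece_primitive_u w ee iT)
  (piece_primitive_u w e0tau iT) tab.
by rewrite piece_length ?(ltnW i2)// !mulr1.
Qed.

Lemma first_piece_primitive (e : R) w : 0 <= e <= tau ->
  primitive 0 1 (XS e w 1) (fun s => f (XS e w 1 s) (needle u tau e v s)).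
Proof. by move=> ee; have := @piece_primitive e w 1 ee; rewrite /= T0; apply. Qed.

Lemma first_piece_primitive0 w :
  primitive 0 1 (XS 0 w 1) (fun s => f (XS 0 w 1 s) (u s)).
Proof. by have := first_piece_primitive w e0tau; rewrite needle0. Qed.

Let u_ctrl1 : control U 0 1 u.
Proof. exact: control_sub u_ctrl. Qed.

Lemma first_piece_variation (e : R) w (t : R) : 0 <= e <= tau -> 0 <= t <= 1 ->
  `|XS e w 1 t - XS 0 w 1 t| <= flow_const * (Du * e).
Proof.
move=> ee t01; have /andP[tau0 tau1] := tau01.
rewrite /flow_const -[2 * K in leRHS]mulr1.
apply: (flow_needle K0 f_lip Du0 f_lipU ee (ltW tau1) u_ctrl1 Uv _
  (first_piece_primitive w ee) (first_piece_primitive0 w) t01).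
by rewrite (piece_start1 w ee) (piece_start1 w e0tau).
Qed.

(** Uniqueness of solutions: up to [tau - e] the controls and the initial values agree, and Gronwall
    gives distance 0. *)
Lemma first_piece_before (e : R) w (t : R) : 0 <= e <= tau -> 0 <= t <= tau - e ->
  XS e w 1 t = XS 0 w 1 t.
Proof.
move=> ee tt; have /andP[tau0 tau1] := tau01; have /andP[e0 et] := ee.
have te : tau - e <= 1 by lra.
have te0 : 0 <= tau - e by lra.
have cu := control_sub (lexx 0) te u_ctrl1.
have p1 := primitive_subr te (first_piece_primitive w ee).
have p2 := primitive_subr te (first_piece_primitive0 w).
have {}p1 : primitive 0 (tau - e) (XS e w 1) (fun s => f (XS e w 1 s) (u s)).
  have [cz _ _] := p1; apply: primitive_eq_oc p1.
    by apply: (f_bmeasv f_cont K0 f_lip f_0 cu); exact: bmeasv_continuous.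
  by move=> s /andP[_ s2]; rewrite needle_left.
have := flow_lipschitz K0 f_lip te0 cu p1 p2 tt.
rewrite (piece_start1 w ee) (piece_start1 w e0tau) subrr normr0 mulr0 normr_le0 subr_eq0.
by move=> /eqP.
Qed.

(** * Bounds that are polynomial in the observations *)

Definition obs_size (w : Omega) : R := 1 + \sum_(i < T) `|y w i.+1|.

Lemma obs_size_ge1 w : 1 <= obs_size w.
Proof. by rewrite lerDl; exact: sumr_ge0. Qed.

(** The lower bound 0 is included so that majorants can be multiplied; [C] and [k] are common to all
    outcomes. *)
Definition polybounded (b : Omega -> R) :=
  exists C (k : nat), forall w, 0 <= b w <= C * obs_size w ^+ k.

Lemma polybounded_cst (C : R) : 0 <= C -> polybounded (fun=> C).
Proof. by move=> C0; exists C, 0%N => w; rewrite C0 expr0 mulr1 lexx. Qed.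

Lemma polyboundedD b b' : polybounded b -> polybounded b' ->
  polybounded (fun w => b w + b' w).
Proof.
move=> [C [k H]] [C' [k' H']]; exists (C + C'), (k + k')%N => w.
have /andP[b0 bC] := H w; have /andP[b0' bC'] := H' w.
(* Because [obs_size] starts from 1, its powers increase with the exponent, and both degrees can be
   raised to their sum. *)
have N1 := obs_size_ge1 w.
have C0 : 0 <= C.
  by rewrite -(@pmulr_lge0 _ (obs_size w ^+ k)) ?(le_trans b0)// exprn_gt0//; lra.
have C0' : 0 <= C'.
  by rewrite -(@pmulr_lge0 _ (obs_size w ^+ k')) ?(le_trans b0')// exprn_gt0//; lra.
rewrite addr_ge0//= mulrDl lerD//.
  by rewrite (le_trans bC)// ler_wpM2l// ler_weXn2l// leq_addr.
by rewrite (le_trans bC')// ler_wpM2l// ler_weXn2l// leq_addl.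
Qed.

Lemma polyboundedM b b' : polybounded b -> polybounded b' ->
  polybounded (fun w => b w * b' w).
Proof.
move=> [C [k H]] [C' [k' H']]; exists (C * C'), (k + k')%N => w.
have /andP[b0 bC] := H w; have /andP[b0' bC'] := H' w.
by rewrite mulr_ge0//= exprD mulrACA ler_pM.
Qed.

Lemma polyboundedX b n : polybounded b -> polybounded (fun w => b w ^+ n).
Proof.
move=> pb; elim: n => [|n IH].
  by have := polybounded_cst ler01.
have := polyboundedM pb IH; congr polybounded; apply/funext => w.
by rewrite exprS.
Qed.

Lemma polybounded_y i : (1 <= i <= T)%N -> polybounded (fun w => `|y w i|).
Proof.
case: i => // i /andP[_ iT]; exists 1, 1%N => w; rewrite normr_ge0 mul1r expr1 /obs_size.
rewrite (bigD1 (Ordinal iT))//= addrCA lerDl addr_ge0//; exact: sumr_ge0.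
Qed.

Lemma polybounded_ge0 b w : polybounded b -> 0 <= b w.
Proof. by move=> [C [k H]]; case/andP: (H w). Qed.

Let Cf0 : 0 <= Cf. Proof. exact: le_trans (f_0 Uv). Qed.

Lemma jump_bounded b i : polybounded b -> (1 <= i <= T)%N ->
  polybounded (fun w => Cg * (1 + b w) ^+ L1 * (1 + `|y w i|) ^+ L2).
Proof.
move=> pb iT; have p1 := polybounded_cst ler01.
apply: polyboundedM; last by apply/polyboundedX/polyboundedD => //; exact: polybounded_y.
by apply: polyboundedM; [exact: polybounded_cst|exact/polyboundedX/polyboundedD].
Qed.

Lemma jump_le (b : R) x yy : `|x| <= b ->
  `|g x yy| <= Cg * (1 + b) ^+ L1 * (1 + `|yy|) ^+ L2.
Proof.
move=> xb; have b0 : 0 <= b by exact: le_trans xb.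
rewrite (le_trans (g_growth _ _))// ler_wpM2r ?exprn_ge0 ?addr_ge0//.
by rewrite ler_wpM2l// lerXn2r ?nnegrE ?addr_ge0// lerD2l.
Qed.

Lemma jump_lip (b : R) x x' yy : `|x| <= b -> `|x'| <= b ->
  `|g x' yy - g x yy| <= Cg * (1 + (b + b)) ^+ L1 * (1 + `|yy|) ^+ L2 * `|x' - x|.
Proof.
move=> xb xb'; have b0 : 0 <= b by exact: le_trans xb.
pose C := Cg * (1 + `|yy|) ^+ L2.
have C0 : 0 <= C by rewrite mulr_ge0// exprn_ge0// addr_ge0.
have dC z w : `|'d (fun z => g z yy) z w| <= C * (1 + `|z|) ^+ L1 * `|w|.
  by rewrite /C [Cg * _ * _]mulrAC; exact: dg_growth.
rewrite (le_trans (@mean_value_growthv _ _ _ (fun z => g z yy) C L1 x x' C0 _ dC))//.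
rewrite ler_wpM2r// /C [leLHS]mulrAC ler_wpM2r ?exprn_ge0 ?addr_ge0// ler_wpM2l//.
by rewrite lerXn2r ?nnegrE ?addr_ge0// lerD2l lerD.
Qed.

(** A jump turns a majorant [b] into a polynomial in [b] and the observation, and the flow adds and
    multiplies by constants. After fewer than [T] jumps the majorant is still polynomial, and it
    does not depend on [e]. *)
Lemma pieces_bounded : exists2 b, polybounded b &
  forall i, (1 <= i <= T)%N -> forall w (e t : R), 0 <= e <= tau ->
  i.-1%:R <= t <= i%:R -> `|XS e w i t| <= b w.
Proof.
(* The condition [i <= T] is doubled so that one copy becomes the range of the induction while the
   other keeps [i] a valid index. *)
suff [b pb H] : exists2 b, polybounded b &
    forall i, (1 <= i <= T)%N -> (i <= T)%N -> forall w (e t : R), 0 <= e <= tau ->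
    i.-1%:R <= t <= i%:R -> `|XS e w i t| <= b w.
  by exists b => // i iT; apply: H => //; case/andP: iT.
have G0 := flow_const_gt0.
elim: {1 4}T (leqnn T) => [_|k IH kT].
  by exists (fun=> 0); [exact: polybounded_cst|case].
have [b pb H] := IH (ltnW kT).
have [b' pb' H'] : exists2 b', polybounded b' & forall w (e t : R), 0 <= e <= tau ->
    k%:R <= t <= k.+1%:R -> `|XS e w k.+1 t| <= b' w.
  case: k {IH} kT H => [|k] kT H.
    exists (fun=> flow_const * (`|x0| + Cf)).
      by apply: polybounded_cst; apply: mulr_ge0; [exact: ltW|exact: addr_ge0].
    move=> w e t ee tt; have := @piece_growth e w 1 t ee kT tt.
    by rewrite /= (piece_start1 w ee).
  exists (fun w => flow_const * (Cg * (1 + b w) ^+ L1 * (1 + `|y w k.+1|) ^+ L2 + Cf)).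
    apply: polyboundedM; first by apply: polybounded_cst; exact: ltW.
    apply: polyboundedD; last exact: polybounded_cst.
    by apply: jump_bounded => //; exact: ltnW.
  move=> w e t ee tt; rewrite (le_trans (@piece_growth e w k.+2 t ee kT tt))// ler_pM2l// lerD2r.
  rewrite (piece_start w ee)// /=; apply: jump_le; apply: H => //; first exact: ltnW.
  by rewrite lexx ler_nat leqnSn.
exists (fun w => b w + b' w); first exact: polyboundedD.
move=> i iT; rewrite leq_eqVlt => /predU1P[->|ik] w e t ee tt.
  by rewrite (le_trans (H' w e t ee tt))// lerDr; exact: polybounded_ge0.
rewrite (le_trans (H i iT ik w e t ee tt))//.
by rewrite lerDl; exact: polybounded_ge0.
Qed.

(** The deviation is created in the first piece, with factor [flow_const * Du]. Each jump multiplies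
    it by a Lipschitz constant of [g] on the ball of radius [bA w], which is polynomial in the
    observations. *)
Lemma pieces_variation : exists2 b, polybounded b &
  forall i, (1 <= i <= T)%N -> forall w (e t : R), 0 <= e <= tau ->
  i.-1%:R <= t <= i%:R -> `|XS e w i t - XS 0 w i t| <= b w * e.
Proof.
have [bA pbA HA] := pieces_bounded.
suff [b pb H] : exists2 b, polybounded b &
    forall i, (1 <= i <= T)%N -> (i <= T)%N -> forall w (e t : R), 0 <= e <= tau ->
    i.-1%:R <= t <= i%:R -> `|XS e w i t - XS 0 w i t| <= b w * e.
  by exists b => // i iT; apply: H => //; case/andP: iT.
have G0 := flow_const_gt0.
elim: {1 4}T (leqnn T) => [_|k IH kT].
  by exists (fun=> 0); [exact: polybounded_cst|case].
have [b pb H] := IH (ltnW kT).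
have [b' pb' H'] : exists2 b', polybounded b' & forall w (e t : R), 0 <= e <= tau ->
    k%:R <= t <= k.+1%:R -> `|XS e w k.+1 t - XS 0 w k.+1 t| <= b' w * e.
  case: k {IH} kT H => [|k] kT H.
    exists (fun=> flow_const * Du); first by apply: polybounded_cst; rewrite mulr_ge0// ltW.
    by move=> w e t ee tt; rewrite -mulrA; exact: first_piece_variation.
  have kT1 : (1 <= k.+1 <= T)%N by exact: ltnW.
  exists (fun w => flow_const * (Cg * (1 + (bA w + bA w)) ^+ L1 * (1 + `|y w k.+1|) ^+ L2 * b w)).
    apply: polyboundedM; first by apply: polybounded_cst; exact: ltW.
    apply: polyboundedM => //; apply: (@jump_bounded (fun w => bA w + bA w)) => //.
    exact: polyboundedD.
  move=> w e t ee tt.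
  rewrite (le_trans (@piece_variation e w k.+2 t ee kT tt))// -mulrA ler_pM2l//.
  rewrite (piece_start w ee)// (piece_start w e0tau)// /=.
  have kk := piece_end k.+1.
  rewrite (le_trans (jump_lip _ (HA _ kT1 w 0 _ e0tau kk) (HA _ kT1 w e _ ee kk)))//.
  rewrite -[leRHS]mulrA ler_wpM2l//; last exact: H.
  by rewrite !mulr_ge0 ?exprn_ge0 ?addr_ge0//; exact: polybounded_ge0.
exists (fun w => b w + b' w); first exact: polyboundedD.
move=> i iT; rewrite leq_eqVlt => /predU1P[->|ik] w e t ee tt.
  rewrite (le_trans (H' w e t ee tt))// ler_wpM2r//; first by case/andP: ee.
  by rewrite lerDr; exact: polybounded_ge0.
rewrite (le_trans (H i iT ik w e t ee tt))// ler_wpM2r//; first by case/andP: ee.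
by rewrite lerDl; exact: polybounded_ge0.
Qed.

Lemma state_bounded : exists2 b, polybounded b &
  forall w (e t : R), 0 <= e <= tau -> 0 <= t <= T%:R -> `|X e w t| <= b w.
Proof.
have [b pb H] := pieces_bounded.
have TT : (1 <= T <= T)%N by rewrite T0 leqnn.
exists (fun w => b w + Cg * (1 + b w) ^+ L1 * (1 + `|y w T|) ^+ L2).
  by apply: polyboundedD => //; exact: jump_bounded.
move=> w e t ee tT; have [[i [iT it Xi]]|XT] := X_cases tT.
  rewrite (Xi e w ee) (le_trans (H i iT w e t ee it))// lerDl.
  exact: polybounded_ge0 (jump_bounded pb TT).
rewrite (XT e w ee) (le_trans (jump_le (b := b w) _ _)) ?lerDr ?polybounded_ge0//.
by apply: H => //; rewrite lexx ler_nat leq_pred.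
Qed.

Lemma state_variation : exists2 b, polybounded b &
  forall w (e t : R), 0 <= e <= tau -> 0 <= t <= T%:R ->
    `|X e w t - X 0 w t| <= b w * e.
Proof.
have [bA pbA HA] := pieces_bounded.
have [b pb H] := pieces_variation.
have TT : (1 <= T <= T)%N by rewrite T0 leqnn.
pose J w := Cg * (1 + (bA w + bA w)) ^+ L1 * (1 + `|y w T|) ^+ L2.
have pJ : polybounded J by apply: (@jump_bounded (fun w => bA w + bA w)) => //; exact: polyboundedD.
(* The second summand accounts for the jump at time [T]. *)
exists (fun w => b w + J w * b w); first by apply: polyboundedD => //; exact: polyboundedM.
move=> w e t ee tT; have /andP[e0 _] := ee; rewrite mulrDl.
have b0 := polybounded_ge0 w pb; have J0 := polybounded_ge0 w pJ.
have [[i [iT it Xi]]|XT] := X_cases tT.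
  rewrite (Xi e w ee) (Xi 0 w e0tau) (le_trans (H i iT w e t ee it))// lerDl.
  by apply: mulr_ge0 => //; exact: mulr_ge0.
rewrite (XT e w ee) (XT 0 w e0tau).
have kk := piece_end T.
rewrite (le_trans (jump_lip _ (HA _ TT w 0 _ e0tau kk) (HA _ TT w e _ ee kk)))//.
rewrite (@le_trans _ _ (J w * (b w * e)))//; last by rewrite mulrA lerDr; exact: mulr_ge0.
by rewrite ler_wpM2l//; exact: H.
Qed.

(** Outcomes are compared through their observations alone, since [Omega] carries no topology. *)
Definition near_obs (w w' : Omega) (r : R) :=
  forall i, (1 <= i <= T)%N -> `|y w i - y w' i| < r.

(** In [y] the jump map is merely continuous, so there is no rate: a radius is pulled back through
    the jumps one after the other. The induction starts from the common initial value [x0]. *)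
Lemma pieces_continuous (e : R) w : 0 <= e <= tau ->
  forall i, (1 <= i <= T)%N -> forall eta : R, 0 < eta -> exists2 r : R, 0 < r &
  forall w', near_obs w w' r -> forall t : R, i.-1%:R <= t <= i%:R ->
    `|XS e w i t - XS e w' i t| < eta.
Proof.
move=> ee; have G0 := flow_const_gt0.
elim=> [|[|i] IH] // iT eta eta0.
  exists 1 => // w' _ t tt.
  rewrite (le_lt_trans (piece_lipschitz w w' ee iT tt))//=.
  by rewrite (piece_start1 w ee) (piece_start1 w' ee) subrr normr0 mulr0.
have /andP[_ iT2] := iT.
have iT1 : (1 <= i.+1 <= T)%N by exact: ltnW.
have [r1 r10 r1P] := continuous_pair_eps g_cont (XS e w i.+1 i.+1%:R) (y w i.+1) (divr_gt0 eta0 G0).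
have [r2 r20 r2P] := IH iT1 r1 r10.
exists (Num.min r1 r2) => [|w' ww' t tt]; first by rewrite lt_min r10.
rewrite (le_lt_trans (piece_lipschitz w w' ee iT tt))// mulrC -ltr_pdivlMr//.
have iT3 : (2 <= i.+2 <= T)%N by [].
rewrite (piece_start w ee iT3) (piece_start w' ee iT3); apply: r1P => /=.
  apply: r2P => [j jT|]; last by rewrite lexx ler_nat leqnSn.
  by have := ww' j jT; rewrite lt_min => /andP[].
by have := ww' _ iT1; rewrite lt_min => /andP[].
Qed.

Lemma state_continuous (e : R) w : 0 <= e <= tau ->
  forall eta : R, 0 < eta -> exists2 r : R, 0 < r &
  forall w', near_obs w w' r -> forall t : R, 0 <= t <= T%:R ->
    `|X e w t - X e w' t| < eta.
Proof.
move=> ee eta eta0.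
have TT : (1 <= T <= T)%N by rewrite T0 leqnn.
have [r1 r10 r1P] := continuous_pair_eps g_cont (XS e w T T%:R) (y w T) eta0.
have /choice[r2 r2P] : forall i : 'I_T, exists r : R, 0 < r /\
  forall w', near_obs w w' r -> forall t : R, i%:R <= t <= i.+1%:R ->
    `|XS e w i.+1 t - XS e w' i.+1 t| < Num.min eta r1.
  move=> i; have [||r r0 rP] := @pieces_continuous e w ee i.+1 _ (Num.min eta r1).
  - by rewrite /= ltn_ord.
  - by rewrite lt_min eta0.
  by exists r.
(* A single radius for all pieces; the default [r1] also controls the last observation, which acts
   only through the final jump. *)
pose r := \big[Num.min/r1]_i r2 i.
have rr2 i : r <= r2 i by rewrite /r; exact: bigmin_le_cond.
exists r.
  by rewrite /r; apply/bigmin_gtP; split=> // i _; case: (r2P i).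
move=> w' ww' t tT.
have key (i : nat) (s : R) : (1 <= i <= T)%N -> i.-1%:R <= s <= i%:R ->
  `|XS e w i s - XS e w' i s| < Num.min eta r1.
  case: i => // i /andP[_ iT] is_.
  have [_] := r2P (Ordinal iT); apply => // j jT.
  exact: lt_le_trans (ww' j jT) (rr2 _).
have [[i [iT it Xi]]|XT] := X_cases tT.
  rewrite (Xi e w ee) (Xi e w' ee); have := key i t iT it.
  by rewrite lt_min => /andP[].
rewrite (XT e w ee) (XT e w' ee); apply: r1P.
  have := key T T%:R TT; rewrite lexx ler_nat leq_pred => /(_ isT).
  by rewrite lt_min => /andP[].
apply: lt_le_trans (ww' T TT) _; rewrite /r; exact: bigmin_le_id.
Qed.

(** * Convergence of the difference quotients of the state *)

Let tau_gt0 : 0 < tau. Proof. by case/andP: tau01. Qed.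
Let tau_lt1 : tau < 1. Proof. by case/andP: tau01. Qed.

Lemma first_piece_bmeasv (e a b : R) w : 0 <= e <= tau -> 0 <= a -> b <= 1 ->
  bmeasv a b (XS e w 1).
Proof.
move=> ee a0 b1; have [cz _ _] := first_piece_primitive w ee.
exact: bmeasv_sub a0 b1 (bmeasv_continuous cz).
Qed.

Lemma control_cst (a b : R) : control U a b (fun=> v).
Proof. by split => // j; exact: bmeas_cst. Qed.

(** Used for the coordinates of [f] and for [c]. On the window both trajectories are close to
    x(tau), the perturbed one because its deviation is of order [e], and [u] is close to u(tau) by
    left continuity. *)
Lemma needle_average (Phi : 'rV[R]_nx -> 'rV[R]_m -> R) w :
  continuous (fun q : 'rV[R]_nx * 'rV[R]_m => Phi q.1 q.2) ->
  (forall (a b : R) z u', control U a b u' -> bmeasv a b z ->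
     bmeas a b (fun s => Phi (z s) (u' s))) ->
  e^-1 * integ (tau - e) tau (fun s => Phi (XS e w 1 s) v - Phi (XS 0 w 1 s) (u s))
    @[e --> 0^'+] --> Phi (XS 0 w 1 tau) v - Phi (XS 0 w 1 tau) (u tau).
Proof.
move=> cPhi bPhi; have G0 := flow_const_gt0.
apply: (average_cvg tau_gt0).
  move=> e /andP[e0 et]; have ee : 0 <= e <= tau by rewrite ltW.
  have t0 : 0 <= tau - e by lra.
  have t1 := ltW tau_lt1.
  apply: bmeasB; apply: bPhi.
  - exact: control_cst.
  - exact: first_piece_bmeasv.
  - exact: control_sub u_ctrl1.
  - exact: first_piece_bmeasv.
move=> eta eta0; set x := XS 0 w 1.
have eta20 : 0 < eta / 2 by rewrite divr_gt0.
have [r1 r10 r1P] := continuous_pair_eps cPhi (x tau) v eta20.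
have [r2 r20 r2P] := continuous_pair_eps cPhi (x tau) (u tau) eta20.
pose rho := Num.min r1 r2.
have rho0 : 0 < rho by rewrite lt_min r10.
have rho40 : 0 < rho / 4 by rewrite divr_gt0.
have [cx _ _] := first_piece_primitive0 w.
have tau_in : 0 <= tau <= 1 by rewrite !ltW.
have [r3 r30 r3P] := within_continuous_eps cx tau_in rho40.
have /cvgrPdist_lt/(_ rho rho0)[r4 /= r40 r4P] := u_left.
have GD0 : 0 < flow_const * Du + 1 by rewrite ltr_wpDl// mulr_ge0// ltW.
(* For [e < r5] the deviation [flow_const * Du * e] is at most [rho / 4]; the added 1 avoids a zero
   denominator. *)
pose r5 := rho / 4 / (flow_const * Du + 1).
have r50 : 0 < r5 by rewrite divr_gt0.
exists (Num.min (Num.min r3 r4) (Num.min r5 tau)); first by rewrite !lt_min r30 r40 r50.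
move=> e; rewrite !lt_min => /andP[e0 /andP[/andP[er3 er4] /andP[er5 et]]] s /andP[s1 s2].
have ee : 0 <= e <= tau by rewrite !ltW.
have s01 : 0 <= s <= 1 by move: tau_lt1 => ?; lra.
have hs3 : `|s - tau| < r3 by rewrite ltr_norml; lra.
have hx : `|x s - x tau| <= rho / 4 := r3P s s01 hs3.
have hxe : `|XS e w 1 s - x s| <= rho / 4.
  rewrite (le_trans (first_piece_variation w ee s01))// mulrA.
  move: er5; rewrite /r5 ltr_pdivlMr// => er5; rewrite ltW// (le_lt_trans _ er5)//.
  by rewrite mulrC ler_pM2l//; lra.
have hu : `|u tau - u s| < rho.
  move: s2; rewrite le_eqVlt => /predU1P[->|s2]; first by rewrite subrr normr0.
  by apply: r4P => //; rewrite /= ltr_norml; lra.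
have hA : `|Phi (x tau) v - Phi (XS e w 1 s) v| < eta / 2.
  apply: r1P; last by rewrite subrr normr0.
  have rr1 : rho <= r1 by rewrite /rho ge_min lexx.
  rewrite (le_lt_trans (ler_distD (x s) _ _))// (lt_le_trans _ rr1)//.
  by rewrite (distrC (x tau)) (distrC (x s) (XS e w 1 s)); lra.
have hB : `|Phi (x tau) (u tau) - Phi (x s) (u s)| < eta / 2.
  have rr2 : rho <= r2 by rewrite /rho ge_min lexx orbT.
  apply: r2P; last exact: lt_le_trans hu rr2.
  by rewrite distrC (lt_le_trans _ rr2)//; lra.
move: hA hB; set A := Phi _ _; set B := Phi _ _; set C := Phi _ _; set D := Phi _ _.
move: A B C D => A B C D; rewrite !ltr_norml ler_norml => /andP[? ?] /andP[? ?].
by apply/andP; split; lra.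
Qed.

Lemma variation_at_tau w : cvg (e^-1 *: (XS e w 1 tau - XS 0 w 1 tau) @[e --> 0^'+]).
Proof.
apply/cvg_ex; exists (f (XS 0 w 1 tau) v - f (XS 0 w 1 tau) (u tau)).
apply: cvg_right_rowP => j.
have cPhi : continuous (fun q : 'rV[R]_nx * 'rV[R]_m => f q.1 q.2 ord0 j).
  move=> q; apply/cvgrPdist_le => e e0; have /cvgrPdist_le/(_ e e0) := @f_cont q.
  apply: filterS => p; apply: le_trans.
  by have := coord_le_norm (f q.1 q.2 - f p.1 p.2) j; rewrite !mxE.
have := @needle_average (fun x u' => f x u' ord0 j) w cPhi
  (fun a b z u' cu' bz => f_bmeasv f_cont K0 f_lip f_0 cu' bz j).
rewrite !mxE; apply: (eq_cvg_right tau_gt0) => e /andP[e0 et].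
have ee : 0 <= e <= tau by rewrite ltW.
have te : 0 <= tau - e <= 1 by move: tau_lt1 => ?; lra.
have tt : tau - e <= tau <= 1 by move: tau_lt1 => ?; lra.
(* Integration starts at [tau - e], where the trajectories still coincide, so the quotient at [tau]
   is exactly an average over the window. *)
have := primitive_sub te (primitiveB (first_piece_primitive w ee) (first_piece_primitive0 w)).
move=> [_ bF /(_ tau tt j)]; rewrite (@first_piece_before e w (tau - e) ee); last by lra.
rewrite [X in _ = X + _](_ : _ = 0); last by rewrite subrr mxE.
rewrite add0r => H.
rewrite [RHS]mxE H; congr (_ * _); symmetry.
apply: eq_integ_oc.
- by apply: bmeas_sub (bF j) => //; exact: ltW.
- by move=> s hs; rewrite needle_in// !mxE.
Qed.

Lemma pieces_cvg w i (t : R) : (1 <= i <= T)%N -> i.-1%:R <= t <= i%:R -> tau <= t ->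
  cvg (e^-1 *: (XS e w i t - XS 0 w i t) @[e --> 0^'+]).
Proof.
have [b pb H] := pieces_variation.
have tt0 (e : R) : 0 < e <= tau -> 0 <= e <= tau by move=> /andP[/ltW -> ->].
elim: i t => [|[|i] IH] t // iT /andP[it ti] taut.
  (* On the first piece the starting time is [tau], after which both trajectories are driven by
     [u]. *)
  apply: (propagate_cvg f_cont K0 f_lip f_0 f_diff (a := tau) (b := 1) (e0 := tau)
    (M := flow_const * Du) (u := u) (z0 := XS 0 w 1) (z := fun e => XS e w 1)) => //.
  - exact: ltW.
  - by apply: control_sub u_ctrl1 => //; exact: ltW.
  - by apply: primitive_sub (first_piece_primitive0 w); rewrite !ltW.
  - move=> e /tt0 ee.
    have t01 : 0 <= tau <= 1 by rewrite !ltW.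
    have p := primitive_sub t01 (first_piece_primitive w ee).
    apply: primitive_eq_oc p.
      apply: (f_bmeasv f_cont K0 f_lip f_0).
        by apply: control_sub u_ctrl1 => //; exact: ltW.
      by apply: first_piece_bmeasv => //; exact: ltW.
    by move=> s /andP[hs _]; rewrite needle_right.
  - move=> e /tt0 ee s /andP[s1 s2]; rewrite -mulrA; apply: first_piece_variation => //.
    by rewrite s2 (le_trans _ s1)// ltW.
  - exact: variation_at_tau.
  - by rewrite taut.
have iT1 : (1 <= i.+1 <= T)%N by exact: ltnW.
have iT2 : (2 <= i.+2 <= T)%N by [].
have i1 := piece_end i.+1.
have tau_i : tau <= i.+1%:R by rewrite (le_trans (ltW tau_lt1))// ler1n.
apply: (propagate_cvg f_cont K0 f_lip f_0 f_diff (a := i.+1%:R) (b := i.+2%:R) (e0 := tau)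
    (M := b w) (u := u) (z0 := XS 0 w i.+2) (z := fun e => XS e w i.+2)) => //.
- by rewrite ler_nat.
- exact: (@piece_control_u i.+2).
- exact: (piece_primitive_u w e0tau iT2).
- by move=> e /tt0 ee; exact: (piece_primitive_u w ee iT2).
- by move=> e /tt0 ee s hs; exact: H.
- have /cvg_ex[l hl] := IH i.+1%:R iT1 i1 tau_i.
  have hM (e : R) : 0 < e <= tau ->
      `|XS e w i.+1 i.+1%:R - XS 0 w i.+1 i.+1%:R| <= b w * e.
    by move=> /tt0 ee; exact: H.
  have := diff_quotient_cvg (@g_diff (XS 0 w i.+1 i.+1%:R) (y w i.+1)) tau_gt0 hM hl.
  move=> hg; apply/cvg_ex; exists ('d (fun z => g z (y w i.+1)) (XS 0 w i.+1 i.+1%:R) l).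
  apply: (eq_cvg_right tau_gt0 _ hg) => e /tt0 ee.
  by rewrite (piece_start w ee iT2) (piece_start w e0tau iT2).
- by rewrite it.
Qed.

Lemma state_cvg w (t : R) : tau <= t <= T%:R ->
  cvg (e^-1 *: (X e w t - X 0 w t) @[e --> 0^'+]).
Proof.
have [b pb H] := pieces_variation.
have tt0 (e : R) : 0 < e <= tau -> 0 <= e <= tau by move=> /andP[/ltW -> ->].
move=> /andP[taut tT].
have tT0 : 0 <= t <= T%:R by rewrite tT (le_trans (ltW tau_gt0)).
have [[i [iT it Xi]]|XT] := X_cases tT0.
  have /cvg_ex[l hl] := @pieces_cvg w _ _ iT it taut.
  apply/cvg_ex; exists l; apply: (eq_cvg_right tau_gt0 _ hl) => e /tt0 ee.
  by rewrite (Xi e w ee) (Xi 0 w e0tau).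
have TT : (1 <= T <= T)%N by rewrite T0 leqnn.
have T1T := piece_end T.
have tauT : tau <= T%:R by rewrite (le_trans taut).
have /cvg_ex[l hl] := @pieces_cvg w _ _ TT T1T tauT.
have hM (e : R) : 0 < e <= tau -> `|XS e w T T%:R - XS 0 w T T%:R| <= b w * e.
  by move=> /tt0 ee; exact: H.
have hg := diff_quotient_cvg (@g_diff (XS 0 w T T%:R) (y w T)) tau_gt0 hM hl.
apply/cvg_ex; exists ('d (fun z => g z (y w T)) (XS 0 w T T%:R) l).
apply: (eq_cvg_right tau_gt0 _ hg) => e /tt0 ee.
by rewrite (XT e w ee) (XT 0 w e0tau).
Qed.

(** * The cost of a trajectory and its right derivative *)

Variables (c : 'rV[R]_nx -> 'rV[R]_m -> R) (h : 'rV[R]_nx -> R) (Cc : R) (L3 : nat).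
Hypothesis c_cont : continuous (fun q : 'rV[R]_nx * 'rV[R]_m => c q.1 q.2).
Hypothesis c_diff : forall x u, differentiable (fun z => c z u) x.
Hypothesis h_diff : forall x, differentiable h x.
Hypothesis Cc0 : 0 <= Cc.
Hypothesis c_growth : forall x u, U u -> `|c x u| <= Cc * (1 + `|x|) ^+ L3.
Hypothesis dc_growth : forall x u w, U u ->
  `|'d (fun z => c z u) x w| <= Cc * (1 + `|x|) ^+ L3 * `|w|.
Hypothesis h_growth : forall x, `|h x| <= Cc * (1 + `|x|) ^+ L3.
Hypothesis dh_growth : forall x w, `|'d h x w| <= Cc * (1 + `|x|) ^+ L3 * `|w|.

Lemma growth_le (b r : R) : 0 <= r -> r <= b ->
  Cc * (1 + r) ^+ L3 <= Cc * (1 + b) ^+ L3.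
Proof.
move=> r0 rb; have b0 := le_trans r0 rb.
by rewrite ler_wpM2l// lerXn2r ?nnegrE ?addr_ge0// lerD2l.
Qed.

Lemma c_le (b : R) x u' : `|x| <= b -> U u' -> `|c x u'| <= Cc * (1 + b) ^+ L3.
Proof. by move=> xb Uu; rewrite (le_trans (c_growth x Uu))//; exact: growth_le. Qed.

Lemma h_le (b : R) x : `|x| <= b -> `|h x| <= Cc * (1 + b) ^+ L3.
Proof. by move=> xb; rewrite (le_trans (h_growth x))//; exact: growth_le. Qed.

Lemma c_lip (b : R) x x' u' : `|x| <= b -> `|x'| <= b -> U u' ->
  `|c x' u' - c x u'| <= Cc * (1 + (b + b)) ^+ L3 * `|x' - x|.
Proof.
move=> xb xb' Uu.
have H := @mean_value_growth _ _ (fun z => c z u') Cc L3 x x' Cc0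
  (fun z => @c_diff z u') (fun z w => dc_growth z w Uu).
by apply: (le_trans H); rewrite ler_wpM2r// growth_le ?addr_ge0// lerD.
Qed.

Lemma h_lip (b : R) x x' : `|x| <= b -> `|x'| <= b ->
  `|h x' - h x| <= Cc * (1 + (b + b)) ^+ L3 * `|x' - x|.
Proof.
move=> xb xb'.
apply: (le_trans (@mean_value_growth _ _ h Cc L3 x x' Cc0 h_diff dh_growth)).
by rewrite ler_wpM2r// growth_le ?addr_ge0// lerD.
Qed.

Lemma c_bmeas (a b : R) z u' : control U a b u' -> bmeasv a b z ->
  bmeas a b (fun s => c (z s) (u' s)).
Proof.
move=> [bu Uu] bz; split; first exact: measurable_fun_comp2.
have [M M0 zM] := bmeasv_bounded bz.
by exists (Cc * (1 + M) ^+ L3) => t tab; apply: c_le; [exact: zM|exact: Uu].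
Qed.

(** The glued trajectory may jump at integer times, so measurability is assembled from half-open
    unit intervals and the point [T]. *)
Lemma state_bmeasv (e : R) w : 0 <= e <= tau -> bmeasv 0 T%:R (X e w).
Proof.
move=> ee j; have [b pb Xb] := state_bounded; split; last first.
  exists (b w) => t tT; rewrite (le_trans (coord_le_norm _ _))//; exact: Xb.
have co : `[0, T%:R]%classic = `[0, T%:R[%classic `|` [set T%:R] :> set R.
  by rewrite setUitv1// bnd_simp.
rewrite co; apply/measurable_funU => //; split; last exact: measurable_fun_set1.
elim: {1 3}T (leqnn T) => [_|k IH kT].
  by rewrite set_itvco0; exact: measurable_fun_set0.
have -> : `[0, k.+1%:R[%classic = `[0, k%:R[%classic `|` `[k%:R, k.+1%:R[%classic :> set R.
  by rewrite -itv_bndbnd_setU// bnd_simp ?ler_nat.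
apply/measurable_funU => //; split; first by apply: IH; exact: ltnW.
have kT1 : (1 <= k.+1 <= T)%N by [].
have [cz _ _] := piece_primitive w ee kT1.
have [mz _] := bmeasv_continuous cz j.
apply: (@eq_measurable_fun _ _ _ _ _ (fun t => XS e w k.+1 t ord0 j)).
  by move=> t; rewrite inE/= in_itv/= => kt; rewrite (X_piece w ee kT1).
by apply: measurable_funS mz => //; apply: subset_itv; rewrite bnd_simp.
Qed.

Definition total_cost (e : R) (w : Omega) : R :=
  integ 0 T%:R (fun t => c (X e w t) (needle u tau e v t)) + h (X e w T%:R).

(** [lim] has a default value where there is no limit; on [[tau, T]] the limit exists by
    [state_cvg]. *)
Definition Psi (w : Omega) (t : R) : 'rV[R]_nx :=
  lim (e^-1 *: (X e w t - X 0 w t) @[e --> 0^'+]).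

Definition cost_derivative (w : Omega) : R :=
  integ tau T%:R (fun t => 'd (fun z => c z (u t)) (X 0 w t) (Psi w t))
  + 'd h (X 0 w T%:R) (Psi w T%:R).

Let tauT : tau <= T%:R. Proof. exact: le_trans (ltW tau_lt1) T1. Qed.

Lemma X_first (e t : R) w : 0 <= e <= tau -> 0 <= t <= tau -> X e w t = XS e w 1 t.
Proof.
move=> ee /andP[t0 tt]; apply: X_piece => //=.
by rewrite t0 (le_lt_trans tt).
Qed.

(** Before [tau - e] the trajectories coincide and contribute nothing; on the window the controls
    are [v] and [u]; after [tau] both controls are [u] and only the states differ. *)
Lemma total_cost_diff (e : R) w : 0 <= e <= tau ->
  total_cost e w - total_cost 0 w =
    integ (tau - e) tau (fun s => c (XS e w 1 s) v - c (XS 0 w 1 s) (u s)) +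
    integ tau T%:R (fun s => c (X e w s) (u s) - c (X 0 w s) (u s)) +
    (h (X e w T%:R) - h (X 0 w T%:R)).
Proof.
move=> ee; have /andP[e0 et] := ee.
have te : 0 <= tau - e by lra.
have tet : tau - e <= tau by lra.
pose ne := needle u tau e v.
have cne : control U 0 T%:R ne by exact: needle_control.
have be : bmeas 0 T%:R (fun t => c (X e w t) (ne t)).
  exact: c_bmeas cne (state_bmeasv w ee).
have b0 : bmeas 0 T%:R (fun t => c (X 0 w t) (u t)).
  exact: c_bmeas u_ctrl (state_bmeasv w e0tau).
have split3 F : bmeas 0 T%:R F -> integ 0 T%:R F =
    integ 0 (tau - e) F + integ (tau - e) tau F + integ tau T%:R F.
  move=> bF; rewrite (@integ_split _ 0 tau T%:R)//; last exact: ltW.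
  by rewrite (@integ_split _ 0 (tau - e) tau)//; exact: bmeas_sub bF.
rewrite /total_cost needle0 (split3 _ be) (split3 _ b0).
have -> : integ 0 (tau - e) (fun t => c (X e w t) (ne t)) =
    integ 0 (tau - e) (fun t => c (X 0 w t) (u t)).
  apply: eq_integ => t /andP[t0 tte]; rewrite /ne needle_left//.
  have tt : 0 <= t <= tau by rewrite t0 (le_trans tte).
  rewrite (X_first w ee tt) (X_first w e0tau tt) first_piece_before//.
  by rewrite t0.
rewrite integB; last 2 first.
- apply: c_bmeas; first exact: control_cst.
  by apply: first_piece_bmeasv => //; exact: ltW.
- apply: c_bmeas; first by apply: control_sub u_ctrl.
  by apply: first_piece_bmeasv => //; exact: ltW.
rewrite integB; last 2 first.
- apply: c_bmeas; first by apply: control_sub u_ctrl => //; exact: ltW.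
  by apply: bmeasv_sub (state_bmeasv w ee) => //; exact: ltW.
- by apply: bmeas_sub b0 => //; exact: ltW.
have -> : integ (tau - e) tau (fun t => c (X e w t) (ne t)) =
    integ (tau - e) tau (fun s => c (XS e w 1 s) v).
  apply: eq_integ_oc; first exact: bmeas_sub be.
  move=> t tt; rewrite /ne needle_in// X_first//.
  by case/andP: tt => t1 ->; rewrite andbT ltW// (le_lt_trans te).
have -> : integ (tau - e) tau (fun t => c (X 0 w t) (u t)) =
    integ (tau - e) tau (fun s => c (XS 0 w 1 s) (u s)).
  apply: eq_integ => t /andP[t1 t2]; rewrite X_first//.
  by rewrite t2 andbT (le_trans te).
have -> : integ tau T%:R (fun t => c (X e w t) (ne t)) =
    integ tau T%:R (fun t => c (X e w t) (u t)).
  apply: eq_integ_oc; first by apply: bmeas_sub be => //; exact: ltW.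
  by move=> t /andP[t1 _]; rewrite /ne needle_right.
ring.
Qed.

Lemma total_cost_bounded : exists2 b, polybounded b &
  forall w (e : R), 0 <= e <= tau -> `|total_cost e w| <= b w.
Proof.
have [b pb Xb] := state_bounded.
pose B w := Cc * (1 + b w) ^+ L3.
have pB : polybounded B.
  apply: polyboundedM; first exact: polybounded_cst.
  by apply/polyboundedX/polyboundedD => //; exact: polybounded_cst.
exists (fun w => B w * T%:R + B w).
  apply: polyboundedD => //; apply: polyboundedM => //; exact: polybounded_cst.
move=> w e ee; rewrite /total_cost (le_trans (ler_normD _ _))// lerD//; last first.
  by apply: h_le; apply: Xb => //; rewrite lexx ler0n.
rewrite -[T%:R in leRHS]subr0; apply: integ_bound => //.
  exact: c_bmeas (needle_control _ _ u_ctrl Uv) (state_bmeasv w ee).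
move=> t tT; apply: c_le; first exact: Xb.
by have [_] := needle_control tau e u_ctrl Uv; apply.
Qed.

(** The window has length [e] and a bounded integrand; elsewhere the Lipschitz estimates make the
    difference of order [e]. This is what dominates the difference quotients under the
    expectation. *)
Lemma total_cost_variation : exists2 b, polybounded b &
  forall w (e : R), 0 <= e <= tau -> `|total_cost e w - total_cost 0 w| <= b w * e.
Proof.
have [bA pbA XA] := state_bounded.
have [bB pbB XB] := state_variation.
have p1 := polybounded_cst ler01.
pose B w := Cc * (1 + bA w) ^+ L3.
have pB : polybounded B.
  apply: polyboundedM; first exact: polybounded_cst.
  exact/polyboundedX/polyboundedD.
pose D w := Cc * (1 + (bA w + bA w)) ^+ L3 * bB w.
have pD : polybounded D.
  apply: polyboundedM => //; apply: polyboundedM; first exact: polybounded_cst.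
  by apply/polyboundedX/polyboundedD => //; exact: polyboundedD.
exists (fun w => (B w + B w) + (D w * T%:R + D w)).
  apply: polyboundedD; first exact: polyboundedD.
  by apply: polyboundedD => //; apply: polyboundedM => //; exact: polybounded_cst.
move=> w e ee; have /andP[e0 et] := ee; rewrite total_cost_diff//.
have te : 0 <= tau - e by lra.
have tet : tau - e <= tau by lra.
have T0T : 0 <= (T%:R : R) <= T%:R by rewrite ler0n lexx.
have XL (s : R) : 0 <= s <= T%:R ->
    Cc * (1 + (bA w + bA w)) ^+ L3 * `|X e w s - X 0 w s| <= D w * e.
  move=> sT; rewrite /D -[leRHS]mulrA ler_wpM2l ?XB// mulr_ge0// exprn_ge0//.
  by rewrite !addr_ge0//; exact: polybounded_ge0.
have h1 : `|integ (tau - e) tau (fun s => c (XS e w 1 s) v - c (XS 0 w 1 s) (u s))|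
    <= (B w + B w) * e.
  rewrite (_ : (B w + B w) * e = (B w + B w) * (tau - (tau - e))); last by ring.
  apply: integ_bound => //.
    apply: bmeasB; apply: c_bmeas.
    - exact: control_cst.
    - by apply: first_piece_bmeasv => //; exact: ltW.
    - exact: control_sub u_ctrl.
    - by apply: first_piece_bmeasv => //; exact: ltW.
  move=> s /andP[s1 s2].
  have st : 0 <= s <= tau by rewrite s2 (le_trans te).
  have sT : 0 <= s <= T%:R by rewrite (le_trans te s1) (le_trans s2).
  rewrite (le_trans (ler_normB _ _))// lerD//; apply: c_le => //.
  - by rewrite -(X_first w ee st); exact: XA.
  - by rewrite -(X_first w e0tau st); exact: XA.
  - exact: u_ctrl.2.
have h2 : `|integ tau T%:R (fun s => c (X e w s) (u s) - c (X 0 w s) (u s))|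
    <= D w * T%:R * e.
  have hb : `|integ tau T%:R (fun s => c (X e w s) (u s) - c (X 0 w s) (u s))|
      <= D w * e * (T%:R - tau).
    apply: integ_bound => //.
      by apply: bmeasB; apply: c_bmeas; try (by apply: control_sub u_ctrl => //; exact: ltW);
        apply: bmeasv_sub (state_bmeasv w _) => //; exact: ltW.
    move=> s /andP[s1 s2].
    have sT : 0 <= s <= T%:R by rewrite s2 (le_trans (ltW tau_gt0)).
    rewrite (le_trans (c_lip (b := bA w) _ _ _)) ?XL ?XA//; exact: u_ctrl.2.
  rewrite (le_trans hb)// [leRHS]mulrAC ler_wpM2l//; last by move: tau_gt0; lra.
  by rewrite mulr_ge0//; exact: polybounded_ge0.
have h3 : `|h (X e w T%:R) - h (X 0 w T%:R)| <= D w * e.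
  by rewrite (le_trans (h_lip (b := bA w) _ _)) ?XL ?XA.
rewrite (le_trans (ler_normD _ _))// (le_trans (lerD (ler_normD _ _) (lexx _)))//.
have -> : (B w + B w + (D w * T%:R + D w)) * e =
  (B w + B w) * e + D w * T%:R * e + D w * e by ring.
by rewrite !lerD.
Qed.

Lemma total_cost_cvg w : e^-1 * (total_cost e w - total_cost 0 w) @[e --> 0^'+] -->
  c (XS 0 w 1 tau) v - c (XS 0 w 1 tau) (u tau) + cost_derivative w.
Proof.
have [bA pbA XA] := state_bounded.
have [bB pbB XB] := state_variation.
have tt0 (e : R) : 0 < e <= tau -> 0 <= e <= tau by move=> /andP[/ltW -> ->].
have XBe (t : R) : 0 <= t <= T%:R -> forall e : R, 0 < e <= tau ->
    `|X e w t - X 0 w t| <= bB w * e.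
  by move=> tT e /tt0 ee; exact: XB.
have sub (t : R) : tau <= t <= T%:R -> 0 <= t <= T%:R.
  by move=> /andP[t1 ->]; rewrite (le_trans (ltW tau_gt0)).
have cPsi (t : R) : tau <= t <= T%:R -> e^-1 *: (X e w t - X 0 w t) @[e --> 0^'+] --> Psi w t.
  by move=> tt; have /cvg_ex[l hl] := @state_cvg w t tt; rewrite /Psi (cvg_lim _ hl).
have h1 := @needle_average c w c_cont c_bmeas.
have h3 : e^-1 * (h (X e w T%:R) - h (X 0 w T%:R)) @[e --> 0^'+] -->
    'd h (X 0 w T%:R) (Psi w T%:R).
  have TT : tau <= (T%:R : R) <= (T%:R : R) by rewrite tauT lexx.
  exact: diff_quotient_cvg (h_diff _) tau_gt0 (XBe _ (sub _ TT)) (cPsi _ TT).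
have bc (e : R) : 0 <= e <= tau -> bmeas tau T%:R (fun t => c (X e w t) (u t)).
  move=> ee'; apply: c_bmeas; first by apply: control_sub u_ctrl => //; exact: ltW.
  by apply: bmeasv_sub (state_bmeasv w ee') => //; exact: ltW.
have h2 : integ tau T%:R (fun t => e^-1 * (c (X e w t) (u t) - c (X 0 w t) (u t)))
    @[e --> 0^'+] -->
    integ tau T%:R (fun t => 'd (fun z => c z (u t)) (X 0 w t) (Psi w t)).
  (* For a fixed outcome the majorants are numbers, so bounded convergence in time suffices here. *)
  apply: (@bounded_cvg_integ R tau T%:R
    (fun e t => e^-1 * (c (X e w t) (u t) - c (X 0 w t) (u t))) _
    (Cc * (1 + (bA w + bA w)) ^+ L3 * bB w) tau tau_gt0 _ _ _).2.
  - by move=> e /tt0 ee; apply: bmeasZ; apply: bmeasB; apply: bc.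
  - move=> e ee t tt; have /andP[e0 et] := ee; have tT := sub t tt.
    rewrite normrM gtr0_norm ?invr_gt0// ler_pdivrMl//.
    have cl := c_lip (XA w 0 t e0tau tT) (XA w e t (tt0 _ ee) tT) (u_ctrl.2 t tT).
    apply: (le_trans cl).
    rewrite mulrCA ler_wpM2l//; last by rewrite mulrC; exact: XBe.
    by rewrite mulr_ge0// exprn_ge0// !addr_ge0//; exact: polybounded_ge0.
  - move=> t tt.
    exact: (diff_quotient_cvg (@c_diff (X 0 w t) (u t)) tau_gt0 (XBe _ (sub _ tt)) (cPsi _ tt)).
rewrite /cost_derivative addrA.
apply: (@eq_cvg_right _ _ (fun e =>
    e^-1 * integ (tau - e) tau (fun s => c (XS e w 1 s) v - c (XS 0 w 1 s) (u s)) +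
    integ tau T%:R (fun t => e^-1 * (c (X e w t) (u t) - c (X 0 w t) (u t))) +
    e^-1 * (h (X e w T%:R) - h (X 0 w T%:R))) _ _ _ tau_gt0); last first.
  by apply: cvgD; [apply: cvgD; [exact: h1|exact: h2]|exact: h3].
move=> e ee; have /andP[e0 et] := ee.
rewrite /= (total_cost_diff w (tt0 _ ee)) integZ; last first.
  by apply: bmeasB; apply: bc => //; exact: tt0.
by rewrite !mulrDr.
Qed.

Lemma total_cost_continuous (e : R) w : 0 <= e <= tau ->
  forall eta : R, 0 < eta -> exists2 r : R, 0 < r &
  forall w', near_obs w w' r -> `|total_cost e w - total_cost e w'| < eta.
Proof.
move=> ee eta eta0; have [bA pbA XA] := state_bounded.
(* The majorants of [w] and [w'] are unrelated; since the states of [w'] stay within 1 of those of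
   [w], [M] bounds both. *)
pose M := bA w + 1.
have M0 : 0 <= M by rewrite addr_ge0//; exact: polybounded_ge0.
pose D := Cc * (1 + (M + M)) ^+ L3.
have D0 : 0 <= D by apply: mulr_ge0 => //; apply: exprn_ge0; lra.
(* [T] comes from the integral, 1 from the terminal cost, and the further 1 makes the final
   inequality strict. *)
pose k := D * (T%:R + 1) + 1.
have k0 : 0 < k by rewrite ltr_wpDl// mulr_ge0// addr_ge0.
have z0 : 0 < Num.min 1 (eta / k) by rewrite lt_min ltr01 divr_gt0.
have [r r0 rP] := state_continuous w ee z0.
exists r => // w' /rP ww'.
have XM (t : R) : 0 <= t <= T%:R -> `|X e w t| <= M /\ `|X e w' t| <= M.
  move=> tT; have h1 := XA w e t ee tT; split; first by rewrite /M; lra.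
  have := ww' t tT; rewrite lt_min => /andP[h2 _].
  rewrite -(subrK (X e w t) (X e w' t)) (le_trans (ler_normD _ _))// distrC /M; lra.
have XD (t : R) : 0 <= t <= T%:R -> `|X e w t - X e w' t| <= eta / k.
  by move=> tT; have := ww' t tT; rewrite lt_min => /andP[_ /ltW].
have cn := needle_control tau e u_ctrl Uv.
have be w1 : bmeas 0 T%:R (fun t => c (X e w1 t) (needle u tau e v t)).
  exact: c_bmeas cn (state_bmeasv w1 ee).
have -> : total_cost e w - total_cost e w' =
  integ 0 T%:R (fun t => c (X e w t) (needle u tau e v t) - c (X e w' t) (needle u tau e v t))
  + (h (X e w T%:R) - h (X e w' T%:R)).
  by rewrite integB// /total_cost; ring.
have h1 : `|integ 0 T%:R (fun t => c (X e w t) (needle u tau e v t) -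
    c (X e w' t) (needle u tau e v t))| <= D * (eta / k) * (T%:R - 0).
  apply: integ_bound => //; first exact: bmeasB.
  move=> t tT; have [Xw Xw'] := XM t tT.
  rewrite (le_trans (c_lip Xw' Xw (cn.2 t tT)))// ler_wpM2l//; exact: XD.
have h2 : `|h (X e w T%:R) - h (X e w' T%:R)| <= D * (eta / k).
  have TT : 0 <= (T%:R : R) <= T%:R by rewrite ler0n lexx.
  have [Xw Xw'] := XM _ TT.
  rewrite (le_trans (h_lip Xw' Xw))// ler_wpM2l//; exact: XD.
rewrite (le_lt_trans (ler_normD _ _))// (le_lt_trans (lerD h1 h2))//.
have -> : D * (eta / k) * (T%:R - 0) + D * (eta / k) = eta * ((k - 1) / k).
  by rewrite (_ : k - 1 = D * (T%:R + 1)); [rewrite subr0; ring|rewrite /k; ring].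
by rewrite -[ltRHS]mulr1 ltr_pM2l// ltr_pdivrMr// mul1r; lra.
Qed.

(** No observation enters before time 1. Hence the jump of the running cost at [tau] is
    deterministic and can leave the expectation. *)
Lemma first_piece_obs w w' (t : R) : 0 <= t <= 1 -> XS 0 w 1 t = XS 0 w' 1 t.
Proof.
move=> t01; apply/eqP; rewrite -subr_eq0 -normr_le0.
rewrite (le_trans (@piece_lipschitz 0 w w' 1 t e0tau T0 t01))//=.
by rewrite (piece_start1 w e0tau) (piece_start1 w' e0tau) subrr normr0 mulr0.
Qed.

(** The interface to the probabilistic part: majorants, pointwise derivative and continuity in the
    observations, with the pieces [XS] gone from the conclusions. *)
Lemma cost_regularity :
  [/\ exists2 b, polybounded b & forall w (e : R), 0 <= e <= tau -> `|total_cost e w| <= b w,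
      exists2 b, polybounded b &
        forall w (e : R), 0 <= e <= tau -> `|total_cost e w - total_cost 0 w| <= b w * e,
      forall w, e^-1 * (total_cost e w - total_cost 0 w) @[e --> 0^'+] -->
        c (X 0 w tau) v - c (X 0 w tau) (u tau) + cost_derivative w &
      forall (e : R) w, 0 <= e <= tau -> forall eta : R, 0 < eta ->
        exists2 r : R, 0 < r &
        forall w', near_obs w w' r -> `|total_cost e w - total_cost e w'| < eta] /\
  (forall w (t : R), tau <= t <= T%:R ->
     cvg (e^-1 *: (X e w t - X 0 w t) @[e --> 0^'+])) /\
  (forall w w', X 0 w tau = X 0 w' tau).
Proof.
have tau_in : 0 <= tau <= tau by rewrite ltW//=.
split; [split|split].
- exact: total_cost_bounded.
- exact: total_cost_variation.
- by move=> w; rewrite (X_first w e0tau tau_in); exact: total_cost_cvg.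
- by move=> e w ee; exact: total_cost_continuous.
- by move=> w t; exact: state_cvg.
- move=> w w'; rewrite (X_first w e0tau tau_in) (X_first w' e0tau tau_in).
  by apply: first_piece_obs; rewrite !ltW.
Qed.

End Hybrid.

(** * Nonnegative random variables with all moments finite *)

Section Moments.
Variables (R : realType) (d : measure_display) (Omega : measurableType d).
Variable P : probability Omega R.

(** All powers at once, since the degree of the majorants is not known in advance. *)
Definition all_moments (F : Omega -> R) :=
  [/\ measurable_fun setT F, forall w, 0 <= F w &
      forall k, P.-integrable setT (EFin \o (fun w => F w ^+ k))].

Lemma all_moments_cst (C : R) : 0 <= C -> all_moments (fun=> C).
Proof. by move=> C0; split => // k; exact: finite_measure_integrable_cst. Qed.

(** The sum is at most twice the larger term. *)
Lemma exprD_le (x y : R) k : 0 <= x -> 0 <= y ->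
  (x + y) ^+ k <= 2 ^+ k * (x ^+ k + y ^+ k).
Proof.
wlog xy : x y / x <= y => [H|] x0 y0.
  have [xy|/ltW yx] := leP x y; first exact: H.
  by rewrite addrC [x ^+ k + _]addrC; exact: H.
rewrite (@le_trans _ _ ((2 * y) ^+ k))//; first by rewrite lerXn2r ?nnegrE; lra.
by rewrite exprMn ler_wpM2l ?exprn_ge0// lerDr exprn_ge0.
Qed.

Lemma all_momentsD F G : all_moments F -> all_moments G ->
  all_moments (fun w => F w + G w).
Proof.
move=> [mF F0 iF] [mG G0 iG]; split; first exact: measurable_funD.
  by move=> w; exact: addr_ge0.
move=> k.
apply: (@le_integrable _ _ _ _ _ measurableT _
  (EFin \o (fun w => 2 ^+ k * (F w ^+ k + G w ^+ k)))).
- by apply/measurable_EFinP; apply: measurable_funX; exact: measurable_funD.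
- move=> w _; rewrite /= lee_fin !ger0_norm ?exprD_le//.
    by rewrite mulr_ge0 ?exprn_ge0// addr_ge0 ?exprn_ge0.
  by rewrite exprn_ge0// addr_ge0.
- rewrite (_ : _ \o _ = (fun w => (2 ^+ k)%:E * ((F w ^+ k)%:E + (G w ^+ k)%:E))%E).
    by apply: integrableZl => //; apply: integrableD => //; [exact: iF|exact: iG].
  by apply/funext => w /=; rewrite -EFinD -EFinM.
Qed.

Lemma all_moments_sum n (F : nat -> Omega -> R) :
  (forall i, (i < n)%N -> all_moments (F i)) ->
  all_moments (fun w => \sum_(i < n) F i w).
Proof.
elim: n => [_|n IH H].
  rewrite (_ : (fun w => _) = fun=> 0); first exact: all_moments_cst.
  by apply/funext => w; rewrite big_ord0.
rewrite (_ : (fun w => _) = fun w => \sum_(i < n) F i w + F n w).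
  by apply: all_momentsD; [apply: IH => i ik; apply: H; exact: ltnW|exact: H].
by apply/funext => w; rewrite big_ord_recr.
Qed.

Lemma all_moments_le (F G : Omega -> R) : all_moments F -> measurable_fun setT G ->
  (forall w, 0 <= G w <= F w) -> all_moments G.
Proof.
move=> [mF F0 iF] mG GF; split => // [w|k]; first by case/andP: (GF w).
apply: le_integrable (iF k) => //; first exact/measurable_EFinP/measurable_funX.
move=> w _; have /andP[G0 GFw] := GF w.
by rewrite /= lee_fin !ger0_norm ?exprn_ge0// lerXn2r ?nnegrE.
Qed.

End Moments.

(** * Integrability and measurability of functions of the observations *)

Section Observations.
Variables (R : realType) (d : measure_display) (Omega : measurableType d).
Variables (P : probability Omega R) (ny T : nat) (Y : nat -> 'I_ny -> Omega -> R).
Hypothesis mY : forall i j, measurable_fun setT (Y i j).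
Hypothesis momY : forall i k, (1 <= i <= T)%N ->
  (\int[P]_w ((norm2 (rvec Y i w)) ^+ k)%:E < +oo)%E.

Lemma all_moments_norm2 i : (1 <= i <= T)%N ->
  all_moments P (fun w => norm2 (rvec Y i w)).
Proof.
move=> iT; have mN : measurable_fun setT (fun w => norm2 (rvec Y i w)).
  apply: (measurableT_comp (continuous_measurable_fun (@sqrt_continuous R))).
  apply: (@eq_measurable_fun _ _ _ _ _ (fun w => \sum_(j < ny) Y i j w ^+ 2)).
    by move=> w _; apply: eq_bigr => j _; rewrite mxE.
  by apply: measurable_sum => j; apply: measurable_funX; exact: mY.
split => // [w|k]; first exact: norm2_ge0.
apply/integrableP; split; first exact/measurable_EFinP/measurable_funX.
under eq_integral => w _ do rewrite /= ger0_norm ?exprn_ge0 ?norm2_ge0//.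
exact: momY.
Qed.

Lemma all_moments_obs i : (1 <= i <= T)%N ->
  all_moments P (fun w => `|rvec Y i w|).
Proof.
move=> iT; apply: all_moments_le (all_moments_norm2 iT) _ _; last first.
  by move=> w; rewrite normr_ge0 norm_le_norm2.
apply: (@measurable_fun_continuous_wrt R _ _ 'I_ny setT (Y i)) => //.
move=> w _ e e0; exists (e / 2); first by rewrite divr_gt0.
move=> w' _ H; apply: (@le_lt_trans _ _ (e / 2)); last by lra.
rewrite (le_trans (ler_dist_dist _ _))//.
apply: norm_le_coord => [|j]; first by rewrite ltW// divr_gt0.
by rewrite !mxE ltW.
Qed.

(** A majorant [b] may fail to be measurable, so it is replaced by the multiple of a power of
    [obs_size] that bounds it. *)
Lemma polybounded_dominated (b : Omega -> R) :
  polybounded T (fun w i => rvec Y i w) b ->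
  exists2 G, P.-integrable setT (EFin \o G) & forall w, b w <= G w.
Proof.
move=> [C [k bC]].
have [_ _ iN] : all_moments P (obs_size T (fun w i => rvec Y i w)).
  apply: all_momentsD; first exact: all_moments_cst.
  by apply: (all_moments_sum (F := fun i w => `|rvec Y i.+1 w|)) => i iT; exact: all_moments_obs.
exists (fun w => C * obs_size T (fun w i => rvec Y i w) w ^+ k).
  rewrite (_ : _ \o _ = (fun w => C%:E * (obs_size T (fun w i => rvec Y i w) w ^+ k)%:E)%E) //.
  by apply: integrableZl => //; exact: iN.
by move=> w; case/andP: (bC w).
Qed.

Lemma polybounded_integrable (b F : Omega -> R) :
  polybounded T (fun w i => rvec Y i w) b -> measurable_fun setT F ->
  (forall w, `|F w| <= b w) -> P.-integrable setT (EFin \o F).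
Proof.
move=> /polybounded_dominated[G iG bG] mF Fb.
apply: le_integrable iG => //; first exact/measurable_EFinP.
by move=> w _; rewrite /= lee_fin (le_trans (Fb w))// (le_trans (bG w))// ler_norm.
Qed.

(** The observations are made of finitely many measurable functions [Y i j], so continuity in them
    gives measurability in the outcome. *)
Lemma measurable_fun_obs (F : Omega -> R) :
  (forall w (eta : R), 0 < eta -> exists2 r : R, 0 < r &
     forall w', near_obs T (fun w i => rvec Y i w) w w' r -> `|F w - F w'| < eta) ->
  measurable_fun setT F.
Proof.
move=> cF.
apply: (@measurable_fun_continuous_wrt R _ _ ('I_T * 'I_ny)%type setT
  (fun ij => Y ij.1.+1 ij.2)) => //.
move=> w _ e e0; have [r r0 rP] := cF w e e0; exists (r / 2); first by rewrite divr_gt0.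
move=> w' _ H; apply: rP => -[|i] // /andP[_ iT].
apply: (@le_lt_trans _ _ (r / 2)); last by lra.
apply: norm_le_coord => [|j]; first by rewrite ltW// divr_gt0.
by rewrite !mxE ltW//; exact: (H (Ordinal iT, j)).
Qed.

End Observations.

(** * Growth hypotheses in product form and in the maximum norm *)

Section GrowthConversion.
Variable R : realType.

Lemma norm20 n : norm2 (0 : 'rV[R]_n) = 0.
Proof.
rewrite /norm2 big1 ?sqrtr0// => j _; by rewrite mxE expr0n.
Qed.

Lemma norm2_growth n (x : 'rV[R]_n) L : (0 < n)%N ->
  (1 + norm2 x) ^+ L <= n%:R ^+ L * (1 + `|x|) ^+ L.
Proof.
move=> n0; have n1 : 1 <= n%:R :> R by rewrite ler1n.
rewrite -exprMn lerXn2r ?nnegrE ?mulr_ge0 ?addr_ge0 ?norm2_ge0//.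
by rewrite mulrDr mulr1 lerD// norm2_le_norm.
Qed.

(** The product form composes well through the jumps; [1 + p] absorbs the constant term because its
    powers are at least 1. *)
Lemma growth1_le (a b p : R) L : 0 <= a -> 0 <= b -> 0 <= p ->
  a + b * p ^+ L <= (a + b) * (1 + p) ^+ L.
Proof.
move=> a0 b0 p0.
have h1 : 1 <= (1 + p) ^+ L by rewrite exprn_ege1// lerDl.
have h2 : p ^+ L <= (1 + p) ^+ L by rewrite lerXn2r ?nnegrE ?addr_ge0// lerDr.
by rewrite mulrDl lerD//; [rewrite ler_peMr|rewrite ler_wpM2l].
Qed.

(** The one-variable estimate is applied in [q], with coefficients depending on [p], and then in
    [p]. *)
Lemma growth2_le (k2 k3 k4 k5 p q : R) L1 L2 :
  0 <= k2 -> 0 <= k3 -> 0 <= k4 -> 0 <= k5 -> 0 <= p -> 0 <= q ->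
  k2 + k3 * p ^+ L1 + k4 * q ^+ L2 + k5 * p ^+ L1 * q ^+ L2 <=
    (k2 + k3 + k4 + k5) * (1 + p) ^+ L1 * (1 + q) ^+ L2.
Proof.
move=> k20 k30 k40 k50 p0 q0.
have pL0 : 0 <= p ^+ L1 by rewrite exprn_ge0.
have -> : k2 + k3 * p ^+ L1 + k4 * q ^+ L2 + k5 * p ^+ L1 * q ^+ L2 =
  (k2 + k3 * p ^+ L1) + (k4 + k5 * p ^+ L1) * q ^+ L2 by ring.
apply: (le_trans (growth1_le _ _ _ _)) => //; try by rewrite addr_ge0// mulr_ge0.
rewrite ler_wpM2r ?exprn_ge0 ?addr_ge0//.
have -> : k2 + k3 + k4 + k5 = (k2 + k4) + (k3 + k5) by ring.
have -> : k2 + k3 * p ^+ L1 + (k4 + k5 * p ^+ L1) = (k2 + k4) + (k3 + k5) * p ^+ L1 by ring.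
by apply: growth1_le => //; exact: addr_ge0.
Qed.

Lemma growth1_norm n (S : R) (x : 'rV[R]_n) L : (0 < n)%N -> 0 <= S ->
  S * (1 + norm2 x) ^+ L <= S * n%:R ^+ L * (1 + `|x|) ^+ L.
Proof. by move=> n0 S0; rewrite -mulrA ler_wpM2l// norm2_growth. Qed.

Lemma growth2_norm n k (S : R) (x : 'rV[R]_n) (y : 'rV[R]_k) L1 L2 :
  (0 < n)%N -> (0 < k)%N -> 0 <= S ->
  S * (1 + norm2 x) ^+ L1 * (1 + norm2 y) ^+ L2 <=
  S * n%:R ^+ L1 * k%:R ^+ L2 * (1 + `|x|) ^+ L1 * (1 + `|y|) ^+ L2.
Proof.
move=> n0 k0 S0.
have -> : S * n%:R ^+ L1 * k%:R ^+ L2 * (1 + `|x|) ^+ L1 * (1 + `|y|) ^+ L2 =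
  S * (n%:R ^+ L1 * (1 + `|x|) ^+ L1) * (k%:R ^+ L2 * (1 + `|y|) ^+ L2) by ring.
apply: ler_pM; rewrite ?norm2_growth ?mulr_ge0 ?exprn_ge0 ?addr_ge0 ?norm2_ge0//.
by rewrite ler_wpM2l// norm2_growth.
Qed.

End GrowthConversion.
Theorem theorem1 (R : realType) (T m nx ny : nat) (rho_max : R)
  (f : 'rV[R]_nx -> 'rV[R]_m -> 'rV[R]_nx) (K1 : R)
  (g : 'rV[R]_nx -> 'rV[R]_ny -> 'rV[R]_nx) (K2 K3 K4 K5 : R) (L1 L2 : nat)
  (c : 'rV[R]_nx -> 'rV[R]_m -> R) (h : 'rV[R]_nx -> R) (K6 K7 : R) (L3 : nat)
  (d : measure_display) (Omega : measurableType d) (P : probability Omega R)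
  (Y : nat -> 'I_ny -> Omega -> R)
  (x0 : 'rV[R]_nx) (u : R -> 'rV[R]_m) (tau : R) (v : 'rV[R]_m)
  (X : R -> Omega -> R -> 'rV[R]_nx) (XS : R -> Omega -> nat -> R -> 'rV[R]_nx) :
  (0 < T)%N -> (0 < m)%N -> (0 < nx)%N -> (0 < ny)%N -> 0 < rho_max ->
  (* f : continuously differentiable, Lipschitz in (x,u) for u in B(0,rho_max) *)
  (forall p : 'rV[R]_nx * 'rV[R]_m,
      differentiable (fun q : 'rV[R]_nx * 'rV[R]_m => f q.1 q.2) p) ->
  (forall w : 'rV[R]_nx * 'rV[R]_m,
      continuous (fun p : 'rV[R]_nx * 'rV[R]_m =>
        'd (fun q : 'rV[R]_nx * 'rV[R]_m => f q.1 q.2) p w)) ->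
  1 <= K1 ->
  (forall (x' x'' : 'rV[R]_nx) (u' u'' : 'rV[R]_m),
      norm2 u' <= rho_max -> norm2 u'' <= rho_max ->
      norm2 (f x' u' - f x'' u'') <= K1 * (norm2 (x' - x'') + norm2 (u' - u''))) ->
  (* g : continuous, differentiable in x, polynomial growth of g and dg/dx *)
  continuous (fun q : 'rV[R]_nx * 'rV[R]_ny => g q.1 q.2) ->
  (forall (x : 'rV[R]_nx) (y : 'rV[R]_ny), differentiable (fun z : 'rV[R]_nx => g z y) x) ->
  0 <= K2 -> 0 <= K3 -> 0 <= K4 -> 0 <= K5 -> (0 < L1)%N -> (0 < L2)%N ->
  (forall (x : 'rV[R]_nx) (y : 'rV[R]_ny),
      norm2 (g x y) <= K2 + K3 * norm2 x ^+ L1 + K4 * norm2 y ^+ L2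
                       + K5 * norm2 x ^+ L1 * norm2 y ^+ L2) ->
  (forall (x : 'rV[R]_nx) (y : 'rV[R]_ny) (w : 'rV[R]_nx),
      norm2 ('d (fun z : 'rV[R]_nx => g z y) x w) <=
        (K2 + K3 * norm2 x ^+ L1 + K4 * norm2 y ^+ L2
         + K5 * norm2 x ^+ L1 * norm2 y ^+ L2) * norm2 w) ->
  (* c : continuous, continuously differentiable in x; h differentiable *)
  continuous (fun q : 'rV[R]_nx * 'rV[R]_m => c q.1 q.2) ->
  (forall (x : 'rV[R]_nx) (u' : 'rV[R]_m), differentiable (fun z : 'rV[R]_nx => c z u') x) ->
  (forall w : 'rV[R]_nx,
      continuous (fun p : 'rV[R]_nx * 'rV[R]_m =>
        'd (fun z : 'rV[R]_nx => c z p.2) (p.1) w)) ->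
  (forall x : 'rV[R]_nx, differentiable h x) ->
  0 <= K6 -> 0 <= K7 -> (0 < L3)%N ->
  (forall (x : 'rV[R]_nx) (u' : 'rV[R]_m), norm2 u' <= rho_max ->
      `|c x u'| <= K6 + K7 * norm2 x ^+ L3) ->
  (forall (x : 'rV[R]_nx) (u' : 'rV[R]_m) (w : 'rV[R]_nx), norm2 u' <= rho_max ->
      `|'d (fun z : 'rV[R]_nx => c z u') x w| <= (K6 + K7 * norm2 x ^+ L3) * norm2 w) ->
  (forall x : 'rV[R]_nx, `|h x| <= K6 + K7 * norm2 x ^+ L3) ->
  (forall (x w : 'rV[R]_nx), `|'d h x w| <= (K6 + K7 * norm2 x ^+ L3) * norm2 w) ->
  (* observations: random vectors with all moments finite *)
  (forall i (j : 'I_ny), measurable_fun setT (Y i j)) ->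
  (forall i k, (1 <= i <= T)%N ->
      (\int[P]_w ((norm2 (rvec Y i w)) ^+ k)%:E < +oo)%E) ->
  (* nominal control, needle time and value *)
  admissible T rho_max u ->
  u @ tau^'- --> u tau ->
  0 < tau < 1 ->
  norm2 v <= rho_max ->
  (* X e w = x^e for omega = w; XS e w i = its i-th piece x_i *)
  (forall e (w : Omega), 0 <= e <= tau ->
      is_trajectory T f g x0 (needle u tau e v) (rvec Y ^~ w) (XS e w) (X e w)) ->
  let J := fun e (w : Omega) =>
    \int[lebesgue_measure]_(t in `[0, T%:R]) c (X e w t) (needle u tau e v t)
    + h (X e w T%:R) in
  let Psi := fun (w : Omega) (t : R) =>
    lim ((fun e : R => e^-1 *: (X e w t - X 0 w t)) @ (0 : R)^'+) in
  let K := fun w : Omega =>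
    \int[lebesgue_measure]_(t in `[tau, T%:R])
        'd (fun z : 'rV[R]_nx => c z (u t)) (X 0 w t) (Psi w t)
    + 'd h (X 0 w T%:R) (Psi w T%:R) in
  (forall e, 0 <= e <= tau -> P.-integrable setT (fun w => (J e w)%:E)) /\
  (forall (w : Omega) t, tau <= t <= T%:R ->
      cvg ((fun e : R => e^-1 *: (X e w t - X 0 w t)) @ (0 : R)^'+)) /\
  P.-integrable setT (fun w => (K w)%:E) /\
  (forall w0 : Omega,
      (fun e : R => e^-1 * (\int[P]_w J e w - \int[P]_w J 0 w)) @ (0 : R)^'+ -->
        c (X 0 w0 tau) v - c (X 0 w0 tau) (u tau) + \int[P]_w K w).
Proof.
move=> T0 m0 nx0 ny0 rho0 f_diff _ K1_1 f_lip g_cont g_diff K20 K30 K40 K50 L10 L20.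
move=> g_gr dg_gr c_cont c_diff _ h_diff K60 K70 L30 c_gr dc_gr h_gr dh_gr mY momY.
move=> [upc ub] u_left tau01 vb traj J0 Psi0 K0.
pose U : set 'rV[R]_m := [set u' | norm2 u' <= rho_max].
(* The dimension factors come from comparing the Euclidean with the maximum norm; the last [nx] in
   [Cg] and [Cc] is for the direction of the differential. [Du] is [K1] times a bound for the
   distance of two control values. *)
pose K := K1 * nx%:R.
pose Du := K1 * (m%:R * (rho_max + rho_max)).
pose Cf := `|f 0 0| + Du.
pose Sg := K2 + K3 + K4 + K5.
pose Cg := Sg * nx%:R ^+ L1 * ny%:R ^+ L2 * nx%:R.
pose Cc := (K6 + K7) * nx%:R ^+ L3 * nx%:R.
pose y (w : Omega) i := rvec Y i w.
have nx1 : 1 <= nx%:R :> R by rewrite ler1n.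
have K1_0 : 0 < K1 by lra.
have Kgt0 : 0 < K by rewrite mulr_gt0// ltr0n.
have Sg0 : 0 <= Sg by rewrite /Sg; lra.
have Sc0 : 0 <= K6 + K7 by lra.
have Du0 : 0 <= Du.
  by apply: mulr_ge0; [exact: ltW|apply: mulr_ge0 => //; lra].
have Cg0 : 0 <= Cg by rewrite /Cg !mulr_ge0 ?exprn_ge0.
have Cc0 : 0 <= Cc by rewrite /Cc !mulr_ge0 ?exprn_ge0.
have U0 : U 0 by rewrite /U/= norm20 ltW.
have U_norm u' : U u' -> `|u'| <= rho_max by apply: le_trans; exact: norm_le_norm2.
have f_cont : continuous (fun q : 'rV[R]_nx * 'rV[R]_m => f q.1 q.2).
  by move=> q; exact: differentiable_continuous.
have f_diffx x u' : differentiable (fun z => f z u') x.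
  apply: (@differentiable_comp _ _ _ _ (fun z => (z, u'))
    (fun q : 'rV[R]_nx * 'rV[R]_m => f q.1 q.2) x); last exact: f_diff.
  exact: differentiable_pair.
have f_lipx x x' u' : U u' -> `|f x u' - f x' u'| <= K * `|x - x'|.
  move=> Uu; rewrite (le_trans (norm_le_norm2 _))// (le_trans (f_lip _ _ _ _ Uu Uu))//.
  by rewrite subrr norm20 addr0 /K -mulrA ler_pM2l//; exact: norm2_le_norm.
have f_lipU x x' u1 u2 : U u1 -> U u2 -> `|f x u1 - f x' u2| <= K * `|x - x'| + Du.
  move=> h1 h2; rewrite (le_trans (norm_le_norm2 _))// (le_trans (f_lip _ _ _ _ h1 h2))//.
  rewrite mulrDr; apply: lerD; first by rewrite /K -mulrA ler_pM2l// norm2_le_norm.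
  rewrite /Du ler_pM2l// (le_trans (norm2_le_norm _))// ler_wpM2l//.
  by rewrite (le_trans (ler_normB _ _))// lerD// U_norm.
have f_0 u' : U u' -> `|f 0 u'| <= Cf.
  move=> Uu; rewrite -(subrK (f 0 0) (f 0 u')) (le_trans (ler_normD _ _))// addrC.
  by rewrite lerD2l (le_trans (f_lipU _ _ _ _ Uu U0))// subrr normr0 mulr0 add0r.
have g_growth x yy : `|g x yy| <= Cg * (1 + `|x|) ^+ L1 * (1 + `|yy|) ^+ L2.
  rewrite (le_trans (norm_le_norm2 _))// (le_trans (g_gr _ _))//.
  rewrite (le_trans (growth2_le _ _ _ _ _ _ _ _))// ?norm2_ge0//.
  rewrite (le_trans (growth2_norm _ _ _ _ nx0 ny0 Sg0))// /Cg.
  rewrite ler_wpM2r ?exprn_ge0 ?addr_ge0// ler_wpM2r ?exprn_ge0 ?addr_ge0//.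
  by rewrite ler_peMr// !mulr_ge0 ?exprn_ge0.
have dg_growth x yy w : `|'d (fun z => g z yy) x w| <=
    Cg * (1 + `|x|) ^+ L1 * (1 + `|yy|) ^+ L2 * `|w|.
  rewrite (le_trans (norm_le_norm2 _))// (le_trans (dg_gr _ _ _))//.
  have h1 := growth2_le L1 L2 K20 K30 K40 K50 (norm2_ge0 x) (norm2_ge0 yy).
  have h2 := le_trans h1 (growth2_norm x yy L1 L2 nx0 ny0 Sg0).
  rewrite (le_trans (ler_wpM2r (norm2_ge0 w) h2))//.
  have -> : Cg * (1 + `|x|) ^+ L1 * (1 + `|yy|) ^+ L2 * `|w| =
    Sg * nx%:R ^+ L1 * ny%:R ^+ L2 * (1 + `|x|) ^+ L1 * (1 + `|yy|) ^+ L2 * (nx%:R * `|w|).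
    by rewrite /Cg; ring.
  by rewrite ler_wpM2l ?norm2_le_norm// !mulr_ge0 ?exprn_ge0 ?addr_ge0.
have cost_growth (x : 'rV[R]_nx) : K6 + K7 * norm2 x ^+ L3 <=
    (K6 + K7) * nx%:R ^+ L3 * (1 + `|x|) ^+ L3.
  exact: le_trans (growth1_le _ K60 K70 (norm2_ge0 x)) (growth1_norm _ _ nx0 Sc0).
have cost_growth1 (x : 'rV[R]_nx) : K6 + K7 * norm2 x ^+ L3 <= Cc * (1 + `|x|) ^+ L3.
  rewrite (le_trans (cost_growth x))// ler_wpM2r ?exprn_ge0 ?addr_ge0//.
  by rewrite ler_peMr// mulr_ge0// exprn_ge0.
have cost_growth2 (x w : 'rV[R]_nx) : (K6 + K7 * norm2 x ^+ L3) * norm2 w <=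
    Cc * (1 + `|x|) ^+ L3 * `|w|.
  rewrite (le_trans (ler_wpM2r (norm2_ge0 w) (cost_growth x)))//.
  have -> : Cc * (1 + `|x|) ^+ L3 * `|w| =
    (K6 + K7) * nx%:R ^+ L3 * (1 + `|x|) ^+ L3 * (nx%:R * `|w|) by rewrite /Cc; ring.
  by rewrite ler_wpM2l ?norm2_le_norm// !mulr_ge0 ?exprn_ge0 ?addr_ge0.
have c_growth x u' : U u' -> `|c x u'| <= Cc * (1 + `|x|) ^+ L3.
  by move=> Uu; exact: le_trans (c_gr x u' Uu) (cost_growth1 x).
have dc_growth x u' w : U u' ->
    `|'d (fun z => c z u') x w| <= Cc * (1 + `|x|) ^+ L3 * `|w|.
  by move=> Uu; exact: le_trans (dc_gr x u' w Uu) (cost_growth2 x w).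
have h_growth x : `|h x| <= Cc * (1 + `|x|) ^+ L3.
  exact: le_trans (h_gr x) (cost_growth1 x).
have dh_growth x w : `|'d h x w| <= Cc * (1 + `|x|) ^+ L3 * `|w|.
  exact: le_trans (dh_gr x w) (cost_growth2 x w).
have u_ctrl : control U 0 T%:R u.
  split => // j; split; first exact: piecewise_continuous_measurable.
  exists rho_max => t tT; rewrite (le_trans (coord_le_norm _ _))//.
  by apply: U_norm; exact: ub.
have [[[bJ pbJ JbJ] [bV pbV JbV] Jcvg Jcont] [Xcvg Xtau]] :=
  @cost_regularity R T m nx ny f g U K Cf Du Cg L1 L2 Omega y x0 u tau v X XS T0
    f_cont Kgt0 f_lipx f_0 f_diffx Du0 f_lipU g_cont g_diff Cg0 g_growth dg_growth
    u_ctrl vb u_left tau01 traj c h Cc L3 c_cont c_diff h_diff Cc0 c_growth dc_growth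
    h_growth dh_growth.
have mJ (e : R) : 0 <= e <= tau -> measurable_fun setT (J0 e).
  by move=> ee; apply: (measurable_fun_obs (T := T) mY) => w; exact: Jcont.
have iJ (e : R) : 0 <= e <= tau -> P.-integrable setT (EFin \o J0 e).
  move=> ee; apply: (polybounded_integrable mY momY pbJ); first exact: mJ.
  by move=> w; exact: JbJ.
have /andP[tau_gt0 tau_lt1] := tau01.
have e0tau : (0 : R) <= (0 : R) <= tau by rewrite lexx ltW.
have tt0 (e : R) : 0 < e <= tau -> 0 <= e <= tau by move=> /andP[/ltW -> ->].
pose c0 w := c (X 0 w tau) v - c (X 0 w tau) (u tau).
have [G iG bVG] := polybounded_dominated mY momY pbV.
have [iF0 cF0] : P.-integrable setT (EFin \o (fun w => c0 w + K0 w)) /\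
    \int[P]_w (e^-1 * (J0 e w - J0 0 w)) @[e --> 0^'+] --> \int[P]_w (c0 w + K0 w).
  apply: (@dominated_cvg_right R _ _ P setT (fun e w => e^-1 * (J0 e w - J0 0 w))
    (fun w => c0 w + K0 w) G tau measurableT tau_gt0) => //.
  - move=> e /tt0 ee; apply: measurable_funM => //.
    by apply: measurable_funB; exact: mJ.
  - move=> e ee w _; have /andP[e_gt0 _] := ee.
    rewrite normrM gtr0_norm ?invr_gt0// ler_pdivrMl// mulrC.
    apply: le_trans (JbV w e (tt0 _ ee)) _.
    by rewrite ler_pM2r.
  - by move=> w _; exact: Jcvg.
have quotE (e : R) : 0 < e <= tau -> \int[P]_w (e^-1 * (J0 e w - J0 0 w)) =
    e^-1 * (\int[P]_w J0 e w - \int[P]_w J0 0 w).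
  move=> /tt0 ee; rewrite RintegralZl//.
    by rewrite RintegralB//; exact: iJ.
  rewrite (_ : _ \o _ = (EFin \o J0 e) \- (EFin \o J0 0%R))%E; last first.
    by apply/funext => w /=; rewrite EFinB.
  by apply: integrableB => //; exact: iJ.
(* Integrability is known for the sum of [c0] and [K0]; as [c0] is constant, equal to its value at
   [w0], it can be subtracted. *)
have K_int (w0 : Omega) : P.-integrable setT (EFin \o K0) /\
    \int[P]_w (c0 w + K0 w) = c0 w0 + \int[P]_w K0 w.
  have c0E w : c0 w = c0 w0 by rewrite /c0 (Xtau w w0).
  have ic : P.-integrable setT (EFin \o cst (c0 w0)) by exact: finite_measure_integrable_cst.
  have iK : P.-integrable setT (EFin \o K0).
    rewrite (_ : EFin \o K0 = (EFin \o (fun w => (c0 w + K0 w)%R)) \- (EFin \o cst (c0 w0)))%E.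
      exact: integrableB.
    by apply/funext => w /=; rewrite c0E -EFinB; congr EFin; rewrite addrC addKr.
  split => //; under eq_Rintegral => w _ do rewrite c0E.
  rewrite RintegralD// Rintegral_cst//; congr (_ + _).
  rewrite [fine _](_ : _ = fine 1%E); first by rewrite mulr1.
  by congr fine; exact: probability_setT.
split; first exact: iJ.
split; first by move=> w t tt; exact: Xcvg.
split.
  (* [K_int] needs an outcome at which to evaluate [c0]; without any outcome, all functions on
     [Omega] are equal. *)
  have [[w0 _]|noW] := pselect (exists w0 : Omega, True); first by have [] := K_int w0.
  rewrite (_ : (fun w => (K0 w)%:E) = cst 0%E); first exact: integrable0.
  by apply/funext => w; exfalso; apply: noW; exists w.
move=> w0; have [_ KE2] := K_int w0.
rewrite KE2 in cF0; apply: (eq_cvg_right tau_gt0 _ cF0); exact: quotE.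
Qed.
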